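(* Let $\mathscr{K}$ be an open convex cone in $\mathbb{R}^n$, let $d\ge1$, and fix $\mathbf{v}\in\mathscr{K}$. The space $\mathbb{P}\mathrm{L}^d_n(\mathscr{K})=\{f\in\mathrm{L}^d_n(\mathscr{K}):f(\mathbf{v})=1\}$, as a subset of $\mathrm{H}^d_n(\mathscr{K})$, is the closure of its interior, and it is contractible to a polynomial in its interior.
   Context: $D_\mathbf{u}=\sum u_i\partial_i$. The lineality space of $\mathscr{K}$ is $L_\mathscr{K}=\overline{\mathscr{K}}\cap-\overline{\mathscr{K}}$. $\mathrm{H}^d_n(\mathscr{K})$ is the linear space of homogeneous degree-$d$ polynomials $f\in\mathbb{R}[t_1,\dots,t_n]$ with $D_\mathbf{w}f\equiv0$ for all $\mathbf{w}\in L_\mathscr{K}$, with its Euclidean topology. $\mathrm{L}^d_n(\mathscr{K})$ is the set of $\mathscr{K}$-Lorentzian polynomials of degree $d$ in $\mathbb{R}[t_1,\dots,t_n]$, where a homogeneous $f$ of degree $d\ge1$ is $\mathscr{K}$-Lorentzian if for all $\mathbf{v}_1,\dots,\mathbf{v}_d\in\mathscr{K}$, $D_{\mathbf{v}_1}\cdots D_{\mathbf{v}_d}f>0$ and (when $d\ge2$) the bilinear form $(\mathbf{x},\mathbf{y})\mapsto D_\mathbf{x}D_\mathbf{y}D_{\mathbf{v}_3}\cdots D_{\mathbf{v}_d}f$ has exactly one positive eigenvalue.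
   Formalization: Interior and closure are taken relative to the affine hyperplane f(v)=1 of H^d_n(K), since the interior in H^d_n(K) itself is empty; contractibility is claimed only for K different from R^n, since for K = R^n the space is empty. *)

(* Defs.v *)
From HB Require Import structures.
From mathcomp Require Import all_boot all_order all_algebra.
From mathcomp Require Import -(notations) mpoly.
From mathcomp Require Import all_classical all_reals all_analysis.

Import Order.TTheory GRing.Theory Num.Theory.
Import numFieldNormedType.Exports.

Local Open Scope classical_set_scope.
Local Open Scope ring_scope.

(* The Euclidean topology on the space [dhomog n R d] of d-forms in n variables:
   a form is identified with its vector of coefficients in R^N.  The monomials
   ['X_{1..n < d.+1}] are those of degree at most d; the ones of degree < d
   contribute null coordinates. *)
Definition form_coefs {R : realType} {n d : nat} (f : dhomog n R d) :
    'rV[R]_#|{: bmultinom n d.+1}| :=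
  \row_i mcoeff (bmnm (enum_val i)) f.

HB.instance Definition _ (R : realType) (n d : nat) :=
  Topological.copy (dhomog n R d) (initial_topology (@form_coefs R n d)).

Section Topology.
Context {T : topologicalType}.
Implicit Types A B : set T.

(* Points outside A are isolated in [subspace A], hence the intersections. *)
Definition rel_interior A B : set T := A `&` @interior (subspace A) B.

Definition rel_closure A B : set T := A `&` @closure (subspace A) B.

Definition contractible_to (R : realType) B (b : T) : Prop :=
  exists F : R * T -> T,
    [/\ {within `[0, 1]%classic `*` B, continuous F},
        forall (t : R) x, 0 <= t <= 1 -> B x -> B (F (t, x)),
        forall x, B x -> F (0, x) = x
      & forall x, B x -> F (1, x) = b].

End Topology.

Section Cones.
Context {R : realType} {n : nat}.
Implicit Types (K : set 'rV[R]_n) (f : mpoly n R) (u v : 'rV[R]_n).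

Definition is_cone K : Prop := forall (c : R) u, 0 < c -> K u -> K (c *: u).

Definition lineality K : set 'rV[R]_n := [set w | closure K w /\ closure K (- w)].

Definition dirD u f : mpoly n R := \sum_(i < n) u 0 i *: mderiv i f.

Definition dirDs (us : seq 'rV[R]_n) f : mpoly n R := foldr dirD f us.

(* Gram matrix, in the standard basis, of (x, y) |-> D_x D_y g for a quadratic
   form g; D_x D_y g is a constant polynomial, read off by its constant term. *)
Definition hessian (g : mpoly n R) : 'M[R]_n :=
  \matrix_(i, j) mcoeff mnm0 (dirD (delta_mx 0 i) (dirD (delta_mx 0 j) g)).

(* Eigenvalues are counted with multiplicity; for the symmetric matrices
   considered here it is the dimension of the eigenspace. *)
Definition one_positive_eigenvalue (A : 'M[R]_n) : Prop :=
  exists a : R, [/\ 0 < a, eigenvalue A a, \rank (eigenspace A a) = 1%N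
    & forall b, 0 < b -> eigenvalue A b -> b = a].

Definition Hspace K (d : nat) : set (dhomog n R d) :=
  [set f : dhomog n R d | forall w, lineality K w -> dirD w f = 0].

Definition Lorentzian K (d : nat) : set (dhomog n R d) :=
  [set f : dhomog n R d | forall us : d.-tuple 'rV[R]_n, (forall i, K (tnth us i)) ->
     0 < mcoeff mnm0 (dirDs us f) /\
     ((2 <= d)%N -> one_positive_eigenvalue (hessian (dirDs (drop 2 us) f)))].

Definition unit_at v (d : nat) : set (dhomog n R d) :=
  [set f : dhomog n R d | meval (fun i => v 0 i) f = 1].

Definition PL K v d : set (dhomog n R d) := Lorentzian K d `&` unit_at v d.

End Cones.

(* Main.v *)
(** Polarise a [d]-form [f] by [polar [:: x1; ..; xd] f = D_x1 .. D_xd f].  For a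
    symmetric matrix, having at most one positive eigenvalue amounts to being
    nonpositive on some hyperplane; this makes two operations visibly preserve
    Lorentzian forms: the pullback [f o A_s] along
    [A_s x = (1 - s) x + s l0(x) v], and [f |-> a f + b l D_v f] with [a > 0],
    [b >= 0] and [l] in the dual cone, whose Hessian at [vs] is nonpositive on the
    hyperplane [D_x D_v D_vs f = 0].  Here [l0] is the mean of normalised dual
    forms [l_1, .., l_m] whose common kernel is the lineality space [L].

    The Hessians of a Lorentzian form have a common kernel, namely
    [{x | D_x f = 0}], and the second operation cuts that kernel down by [ker l].
    Hence for [0 < t <= 1] the form
      [F(t, f) = (T_t^(l_1) .. T_t^(l_m) (f o A_t)) o A_(t/2)]
    has nondegenerate Hessians modulo [L], also along the closure of the cone,
    because [A_(t/2)] maps a compact base of the closed cone into the open one.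
    Compactness makes this an open condition, so [F(t, f)] is interior.  Finally
    [F(0, f) = f], and [F(1, f)] is the same form for all normalised [f], because
    [f o A_1 = f(v) l0^d]. *)

Require Import Defs.
From HB Require Import structures.
From mathcomp Require Import all_boot all_order all_algebra.
From mathcomp Require Import -(notations) mpoly.
From mathcomp Require Import all_classical all_reals all_analysis.
From mathcomp Require Import ring lra.

Import Order.TTheory GRing.Theory Num.Theory.
Import numFieldNormedType.Exports.

Local Open Scope classical_set_scope.
Local Open Scope ring_scope.

Local Notation homog d f := (f \is @ishomog1 _ _ d mdeg).

(** * Directional derivatives of polynomials and polarisation of forms *)

Section DirectionalDerivatives.
Context {R : realType} {n : nat}.
Implicit Types (f g : mpoly n R) (u v w x y : 'rV[R]_n) (us vs : seq 'rV[R]_n).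
Implicit Types (l : 'cV[R]_n).

Lemma dirD_is_linear u : linear (dirD u : mpoly n R -> mpoly n R).
Proof.
move=> a f g; rewrite /dirD scaler_sumr -big_split; apply: eq_bigr => i _ /=.
by rewrite mderivD mderivZ scalerDr !scalerA mulrC.
Qed.

HB.instance Definition _ u :=
  GRing.isLinear.Build R (mpoly n R) (mpoly n R) _ (dirD u) (dirD_is_linear u).

Lemma dirDZ u a f : dirD u (a *: f) = a *: dirD u f.
Proof. exact: linearZ. Qed.

Lemma dirDs_is_linear us : linear (dirDs us : mpoly n R -> mpoly n R).
Proof. by elim: us => [|u us IH] a f g //=; rewrite IH linearP. Qed.

HB.instance Definition _ us :=
  GRing.isLinear.Build R (mpoly n R) (mpoly n R) _ (dirDs us)
    (dirDs_is_linear us).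

Lemma dirD_comb a u w f : dirD (a *: u + w) f = a *: dirD u f + dirD w f.
Proof.
rewrite /dirD scaler_sumr -big_split; apply: eq_bigr => i _ /=.
by rewrite !mxE scalerDl scalerA.
Qed.

Lemma dirDZl a u f : dirD (a *: u) f = a *: dirD u f.
Proof.
by rewrite /dirD scaler_sumr; apply: eq_bigr => i _; rewrite mxE scalerA.
Qed.

Lemma mderiv_dirD i w f :
  mderiv i (dirD w f) = \sum_(j < n) w 0 j *: mderiv i (mderiv j f).
Proof.
rewrite /dirD (big_morph (mderiv i) (mderivD i) (mderiv0 _ i)).
by apply: eq_bigr => j _; rewrite mderivZ.
Qed.

Lemma dirDC u w f : dirD u (dirD w f) = dirD w (dirD u f).
Proof.
rewrite {1 3}/dirD.
under eq_bigr do rewrite mderiv_dirD.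
under [RHS]eq_bigr do rewrite mderiv_dirD.
under eq_bigr do rewrite scaler_sumr.
rewrite exchange_big; apply: eq_bigr => j _.
rewrite scaler_sumr; apply: eq_bigr => i _ /=.
by rewrite !scalerA mulrC mderiv_comm.
Qed.

Lemma dirDM u f g : dirD u (f * g) = dirD u f * g + f * dirD u g.
Proof.
rewrite /dirD mulr_suml mulr_sumr -big_split; apply: eq_bigr => i _ /=.
by rewrite mderivM scalerDr scalerAl scalerAr.
Qed.

Lemma dirDs_cat us vs f : dirDs (us ++ vs) f = dirDs us (dirDs vs f).
Proof. exact: foldr_cat. Qed.

Lemma dirDs_dirD us u f : dirDs us (dirD u f) = dirD u (dirDs us f).
Proof. by elim: us => //= w us ->; rewrite dirDC. Qed.

Lemma dirDs_perm us vs f : perm_eq us vs -> dirDs us f = dirDs vs f.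
Proof.
elim: us vs => [|u us IH] vs; first by rewrite perm_sym => /perm_nilP ->.
move=> p; have uvs : u \in vs by rewrite -(perm_mem p) mem_head.
case/path.splitPr: uvs p => v1 v2 p.
have -> : dirDs (v1 ++ u :: v2) f = dirD u (dirDs (v1 ++ v2) f).
  by rewrite !dirDs_cat /= dirDs_dirD.
by move: p; rewrite perm_sym -[u :: v2]cat1s perm_catCA /= perm_cons perm_sym => /IH <-.
Qed.

Definition linform l u : R := (u *m l) 0 0.

Definition linpoly l : mpoly n R := \sum_(i < n) l i 0 *: mpolyX R (mnm1 i).

Lemma linform_comb l a u w : linform l (a *: u + w) = a * linform l u + linform l w.
Proof. by rewrite /linform mulmxDl -scalemxAl !mxE. Qed.

Lemma linformZ l a u : linform l (a *: u) = a * linform l u.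
Proof. by rewrite /linform -scalemxAl !mxE. Qed.

Lemma linformD l u w : linform l (u + w) = linform l u + linform l w.
Proof. by rewrite /linform mulmxDl !mxE. Qed.

Lemma linformN l u : linform l (- u) = - linform l u.
Proof. by rewrite /linform mulNmx mxE. Qed.

Lemma dirD_linpolyM l u g :
  dirD u (linpoly l * g) = linform l u *: g + linpoly l * dirD u g.
Proof.
rewrite dirDM; congr (_ + _); rewrite -mul_mpolyC; congr (_ * _).
rewrite /linpoly raddf_sum /linform !mxE raddf_sum; apply: eq_bigr => j _ /=.
rewrite /dirD (bigD1 j) //= big1 ?addr0 => [|i ij].
  rewrite mderivZ mderivX mnm1E eqxx scale1r.
  have -> : mnm_sub (mnm1 j) (mnm1 j) = mnm0.
    by apply/mnmP => k; rewrite mnmBE subnn mnm0E.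
  by rewrite mpolyX0 scalerA alg_mpolyC.
by rewrite mderivZ mderivX mnm1E eq_sym (negPf ij) scale0r !scaler0.
Qed.

Lemma homog_coef d f m : homog d f -> mdeg m != d -> mcoeff m f = 0.
Proof. exact: dhomog_nemf_coeff. Qed.

Lemma homog_from_coef d f :
  (forall m, mdeg m != d -> mcoeff m f = 0) -> homog d f.
Proof.
move=> h; apply/dhomogP => m; rewrite mcoeff_msupp => /eqP mf.
by apply/eqP; apply: contrapT => /negP /h.
Qed.

Lemma homog_dirD d u f : homog d.+1 f -> homog d (dirD u f).
Proof.
move=> hf; apply: homog_from_coef => m md; rewrite /dirD raddf_sum big1 // => i _.
rewrite /= mcoeffZ mcoeff_deriv (homog_coef _ _ _ hf) ?mul0rn ?mulr0 //.
by rewrite mdegD mdeg1 addn1 eqSS.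
Qed.

Lemma homog_dirDs d us f : homog (d + size us)%N f -> homog d (dirDs us f).
Proof.
elim: us d => [|u us IH] d /=; first by rewrite addn0.
by rewrite addnS -addSn => /IH; apply: homog_dirD.
Qed.

Lemma homog0_dirD u f : homog 0%N f -> dirD u f = 0.
Proof.
move=> hf; apply/mpolyP => m; rewrite mcoeff0 /dirD raddf_sum big1 // => i _.
rewrite /= mcoeffZ mcoeff_deriv (homog_coef _ _ _ hf) ?mul0rn ?mulr0 //.
by rewrite mdegD mdeg1 addn1.
Qed.

Lemma homog0_const f : homog 0%N f -> f = mpolyC n (mcoeff mnm0 f).
Proof.
move=> hf; apply/mpolyP => m; rewrite mcoeffC.
have [->|m0] := eqVneq m mnm0; first by rewrite mulr1.
by rewrite mulr0 (homog_coef _ _ _ hf) // mdeg_eq0.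
Qed.

Lemma homog_linpolyM d l g : homog d g -> homog d.+1 (linpoly l * g).
Proof.
move=> hg; rewrite -add1n; apply: dhomogM => //.
apply: rpred_sum => i _; apply: rpredZ.
by rewrite dhomogX /= mdeg1.
Qed.

Definition polar us f : R := mcoeff mnm0 (dirDs us f).

Lemma polar_is_linear us : linear_for *%R (polar us).
Proof. by move=> a f g; rewrite /polar linearP /= mcoeffD mcoeffZ. Qed.

HB.instance Definition _ us :=
  GRing.isLinear.Build R (mpoly n R) R _ (polar us) (polar_is_linear us).

Lemma polarZ us a f : polar us (a *: f) = a * polar us f.
Proof. exact: linearZ. Qed.

Lemma polar_perm us vs f : perm_eq us vs -> polar us f = polar vs f.
Proof. by rewrite /polar => /dirDs_perm ->. Qed.

Lemma polar_cons u us f : polar (u :: us) f = polar us (dirD u f).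
Proof. by rewrite /polar dirDs_dirD. Qed.

Lemma polar_comb a u w us f :
  polar (a *: u + w :: us) f = a * polar (u :: us) f + polar (w :: us) f.
Proof. by rewrite /polar /= dirD_comb mcoeffD mcoeffZ. Qed.

Lemma polarDl u w us f :
  polar (u + w :: us) f = polar (u :: us) f + polar (w :: us) f.
Proof. by rewrite -[u]scale1r polar_comb mul1r scale1r. Qed.

Lemma polar0l us f : polar (0 :: us) f = 0.
Proof. by have := polarDl 0 0 us f; rewrite addr0; lra. Qed.

Lemma polarZl a u us f : polar (a *: u :: us) f = a * polar (u :: us) f.
Proof. by rewrite /polar /= dirDZl mcoeffZ. Qed.

Lemma polar_swap u w us f : polar (u :: w :: us) f = polar (w :: u :: us) f.
Proof. by rewrite /polar /= dirDC. Qed.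

Lemma polarZl2 a u x us f :
  polar (x :: a *: u :: us) f = a * polar (x :: u :: us) f.
Proof. by rewrite !(polar_swap x) polarZl. Qed.

Definition remove_nth (i : nat) us := take i us ++ drop i.+1 us.

Lemma perm_remove_nth i us : (i < size us)%N ->
  perm_eq us (nth 0 us i :: remove_nth i us).
Proof.
move=> ius; rewrite -{1}(cat_take_drop i us) (drop_nth 0 ius).
by rewrite -cat1s perm_catCA.
Qed.

Lemma size_remove_nth i us : (i < size us)%N -> size (remove_nth i us) = (size us).-1.
Proof. by move=> /perm_remove_nth/perm_size => ->. Qed.

Lemma mem_remove_nth i us : {subset remove_nth i us <= us}.
Proof. by move=> x; rewrite mem_cat => /orP[/mem_take|/mem_drop]. Qed.

(** Leibniz rule: since [linpoly l] has degree one, at most one of the derivatives falls on it. *)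
Lemma dirDs_linpolyM us l g :
  dirDs us (linpoly l * g) = linpoly l * dirDs us g +
    \sum_(i < size us) linform l (nth 0 us i) *: dirDs (remove_nth i us) g.
Proof.
elim: us => [|u us IH] /=; first by rewrite big_ord0 addr0.
rewrite IH linearD /= dirD_linpolyM big_ord_recl /= {2}/remove_nth /= drop0.
rewrite -addrA addrCA; congr (_ + (_ + _)).
rewrite raddf_sum; apply: eq_bigr => i _; rewrite /= linearZ /=.
by rewrite /bump /= add1n.
Qed.

Lemma polar_linpolyM us l g : polar us (linpoly l * g) =
  \sum_(i < size us) linform l (nth 0 us i) * polar (remove_nth i us) g.
Proof.
rewrite /polar dirDs_linpolyM mcoeffD raddf_sum /= rmorphM /=.
(* A linear form has no constant term, so the term where no derivative falls on it drops out. *)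
rewrite (_ : mcoeff mnm0 (linpoly l) = 0) ?mul0r ?add0r.
  by apply: eq_bigr => i _; rewrite mcoeffZ.
rewrite /linpoly raddf_sum big1 // => i _ /=.
by rewrite mcoeffZ mcoeffX mnm1_eq0 mulr0.
Qed.

Lemma polar_homog0 f : homog 0%N f -> f = mpolyC n (polar [::] f).
Proof. exact: homog0_const. Qed.

Lemma dirD_delta i f : dirD (delta_mx 0 i) f = mderiv i f.
Proof.
rewrite /dirD (bigD1 i) //= big1 ?addr0 => [|j ji].
  by rewrite mxE !eqxx scale1r.
by rewrite mxE eqxx (negPf ji) scale0r.
Qed.

(** By induction all partial derivatives vanish. A monomial of positive degree contains some
    variable, and the partial derivative in that variable determines its coefficient up to a nonzero
    integer. *)
Lemma homog_polar_eq0 d f : homog d f ->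
  (forall us, size us = d -> polar us f = 0) -> f = 0.
Proof.
elim: d f => [|d IH] f hf P0.
  by rewrite (polar_homog0 _ hf) P0 // mpolyC0.
have D0 i : mderiv i f = 0.
  rewrite -dirD_delta; apply: IH; first exact: homog_dirD.
  by move=> us us_d; rewrite -polar_cons P0 //= us_d.
apply/mpolyP => m; rewrite mcoeff0.
have [md|] := eqVneq (mdeg m) d.+1; last exact: homog_coef hf.
have [m0|/existsP[i mi]] := boolP [forall i, m i == 0%N].
  move: md; rewrite mdegE big1 // => i _.
  by move/forallP: m0 => /(_ i) /eqP.
pose k := mnm_sub m (mnm1 i).
have km : m = mnm_add k (mnm1 i).
  apply/mnmP => j; rewrite mnmDE mnmBE mnm1E.
  by case: eqVneq => [<-|_] /=; rewrite ?subn0 ?addn0 ?subnK ?lt0n.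
have := mcoeff_deriv i k f; rewrite D0 mcoeff0 -km => /esym/eqP.
by rewrite mulrn_eq0 /= => /eqP.
Qed.

(** Euler's identity, checked on monomials. *)
Lemma meval_dirD_homog d v f : homog d f ->
  meval (fun i => v 0 i) (dirD v f) = d%:R * meval (fun i => v 0 i) f.
Proof.
move=> hf; rewrite [in RHS](mpolyE f) [in LHS](mpolyE f) (raddf_sum (dirD v)).
rewrite !(raddf_sum (meval _)) mulr_sumr /=.
apply: eq_big_seq => m mf.
rewrite /= linearZ /= !mevalZ mulrCA; congr (_ * _).
have md : mdeg m = d := dhomog_mf hf mf.
rewrite /dirD raddf_sum mevalX -md mdegE natr_sum mulr_suml.
apply: eq_bigr => i _ /=; rewrite mderivX !mevalZ mevalX.
have [->|mi] := eqVneq (m i) 0%N; first by rewrite !mul0r mulr0.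
rewrite mulrCA; congr (_ * _).
rewrite (bigD1 i) //= [RHS](bigD1 i) //= mulrA; congr (_ * _).
  by rewrite mnmBE mnm1E eqxx -exprS subn1 prednK // lt0n.
by apply: eq_bigr => j ji; rewrite mnmBE mnm1E eq_sym (negPf ji) subn0.
Qed.

(** Iterated Euler identity; it turns the normalisation of [f] at [v] into a condition on
    [polar]. *)
Lemma polar_nseq_meval d v f : homog d f ->
  polar (nseq d v) f = (d`!)%:R * meval (fun i => v 0 i) f.
Proof.
elim: d f => [|d IH] f hf.
  by rewrite {2}(homog0_const _ hf) mevalC mul1r.
rewrite /= polar_cons IH; last exact: homog_dirD.
by rewrite (meval_dirD_homog _ _ _ hf) mulrA -natrM mulnC factS.
Qed.

Lemma dirDE u f : dirD u f = \sum_(i < n) u 0 i *: dirD (delta_mx 0 i) f.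
Proof. by rewrite {1}/dirD; apply: eq_bigr => i _; rewrite dirD_delta. Qed.

Lemma hessian_polar vs f x y :
  (x *m hessian (dirDs vs f) *m y^T) 0 0 = polar (x :: y :: vs) f.
Proof.
rewrite /polar /= dirDE [dirD y _]dirDE raddf_sum /= -mulmxA mxE.
apply: eq_bigr => i _; rewrite mcoeffZ; congr (_ * _).
rewrite (raddf_sum (dirD _)) (raddf_sum (mcoeff _)) mxE; apply: eq_bigr => j _.
by rewrite /= dirDZ mcoeffZ !mxE mulrC.
Qed.

Lemma hessian_sym g : (hessian g)^T = hessian g.
Proof. by apply/matrixP => i j; rewrite !mxE dirDC. Qed.

End DirectionalDerivatives.

(** * Limits of finite sums and of matrices *)

Section Continuity.
Context {R : realType}.

Lemma cvg_sum (T : Type) (F : set_system T) (I : Type) (r : seq I)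
    (P : pred I) (f : I -> T -> R) (a : I -> R) : Filter F ->
  (forall i, P i -> f i x @[x --> F] --> a i) ->
  (\sum_(i <- r | P i) f i x) @[x --> F] --> \sum_(i <- r | P i) a i.
Proof. by move=> FF fa; exact: (@cvg_big R I +%R 0 P (@add_continuous R) T F r f a FF fa). Qed.

Lemma cvg_mx_coord (T : Type) (F : set_system T) m n (f : T -> 'M[R]_(m, n))
    (A : 'M[R]_(m, n)) : Filter F ->
  (forall i j, f x i j @[x --> F] --> A i j) -> f x @[x --> F] --> A.
Proof.
move=> FF fA U [P PA PU]; suff : \forall x \near F, forall i j, P i j (f x i j).
  by apply: filterS => x Px; apply: PU.
by apply: filter_forall => i; apply: filter_forall => j; exact: fA (PA i j).
Qed.

Lemma cvg_coord m n (A : 'M[R]_(m, n)) i j : B i j @[B --> A] --> A i j.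
Proof. exact: coord_continuous. Qed.

End Continuity.

(** * Quadratic forms and the Rayleigh quotient *)

Section QuadraticForms.
Context {R : realType} {n : nat}.
Implicit Types (A : 'M[R]_n) (x y u e : 'rV[R]_n) (l : 'cV[R]_n).

Definition qform A x y : R := (x *m A *m y^T) 0 0.

Definition dot x y : R := (x *m y^T) 0 0.

Lemma qform_comb A a x u y : qform A (a *: x + u) y = a * qform A x y + qform A u y.
Proof. by rewrite /qform !mulmxDl -!scalemxAl !mxE. Qed.

Lemma qform_combr A a x u y : qform A y (a *: x + u) = a * qform A y x + qform A y u.
Proof. by rewrite /qform linearP /= mulmxDr -!scalemxAr !mxE. Qed.

Lemma qform_sym A x y : A^T = A -> qform A x y = qform A y x.
Proof.
move=> As; rewrite /qform -[in LHS](trmxK (_ *m y^T)) mxE !trmx_mul trmxK As.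
by rewrite mulmxA.
Qed.

Lemma dot_comb a x u y : dot (a *: x + u) y = a * dot x y + dot u y.
Proof. by rewrite /dot mulmxDl -scalemxAl !mxE. Qed.

Lemma dotC x y : dot x y = dot y x.
Proof. by rewrite /dot !mxE; apply: eq_bigr => i _; rewrite !mxE mulrC. Qed.

Lemma dotDl x u y : dot (x + u) y = dot x y + dot u y.
Proof. by rewrite /dot mulmxDl mxE. Qed.

Lemma dotZl a x y : dot (a *: x) y = a * dot x y.
Proof. by rewrite /dot -scalemxAl mxE. Qed.

Lemma dotNl x y : dot (- x) y = - dot x y.
Proof. by rewrite /dot mulNmx mxE. Qed.

Lemma dotDr x u y : dot y (x + u) = dot y x + dot y u.
Proof. by rewrite dotC dotDl !(dotC y). Qed.

Lemma dotZr a x y : dot y (a *: x) = a * dot y x.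
Proof. by rewrite dotC dotZl dotC. Qed.

Lemma dotNr x y : dot y (- x) = - dot y x.
Proof. by rewrite dotC dotNl dotC. Qed.

Definition dot_lin := (dotDl, dotDr, dotZl, dotZr, dotNl, dotNr).

Lemma dotE x y : dot x y = \sum_i x 0 i * y 0 i.
Proof. by rewrite /dot mxE; apply: eq_bigr => i _; rewrite mxE. Qed.

Lemma dot_ge0 x : 0 <= dot x x.
Proof. by rewrite dotE sumr_ge0 // => i _; rewrite -expr2 sqr_ge0. Qed.

Lemma dot_eq0 x : dot x x = 0 -> x = 0.
Proof.
move=> /eqP; rewrite dotE psumr_eq0 => [/allP x0|i _]; last by rewrite -expr2 sqr_ge0.
apply/rowP => i; have := x0 i (mem_index_enum _).
by rewrite mulf_eq0 orbb mxE => /eqP.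
Qed.

Lemma dot_gt0 x : x != 0 -> 0 < dot x x.
Proof.
by move=> x0; rewrite lt_neqAle dot_ge0 andbT eq_sym; apply: contra_neq x0 => /dot_eq0.
Qed.

Lemma qformZ A a x : qform A (a *: x) (a *: x) = a ^+ 2 * qform A x x.
Proof.
rewrite -[a *: x]addr0 qform_comb !qform_combr.
rewrite /qform !mul0mx trmx0 !mulmx0 !mxE; ring.
Qed.

Lemma dotZ a x : dot (a *: x) (a *: x) = a ^+ 2 * dot x x.
Proof.
rewrite /dot linearZ /= -scalemxAl -scalemxAr !mxE; ring.
Qed.

Lemma cvg_qform A x : qform A y y @[y --> x] --> qform A x x.
Proof.
rewrite /qform; under eq_fun do rewrite mxE; rewrite mxE.
apply: (@cvg_sum R _ (nbhs x)) => i _; apply: cvgM; last first.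
  by under eq_fun do rewrite mxE; rewrite mxE; exact: cvg_coord.
under eq_fun do rewrite mxE; rewrite mxE; apply: (@cvg_sum R _ (nbhs x)) => j _.
by apply: cvgMl; exact: cvg_coord.
Qed.

Lemma qform1 x y : qform 1%:M x y = dot x y.
Proof. by rewrite /qform mulmx1. Qed.

Lemma norm_le_dot x : `|x| <= 1 + dot x x.
Proof.
rewrite [leLHS]/Num.norm /= mx_normrE; apply/bigmax_leP; split.
  by rewrite addr_ge0 // dot_ge0.
move=> [i j] _ /=; rewrite [i]ord1.
have : `|x 0 j| ^+ 2 <= dot x x.
  rewrite real_normK ?num_real // dotE (bigD1 j) //= -expr2 lerDl.
  by apply: sumr_ge0 => k _; rewrite -expr2 sqr_ge0.
by have := sqr_ge0 (`|x 0 j| - 1); rewrite !expr2; nra.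
Qed.

Lemma compact_unit_sphere m (B : 'M[R]_(n, m)) :
  compact [set x : 'rV[R]_n | x *m B = 0 /\ dot x x = 1].
Proof.
apply: bounded_closed_compact.
  exists (1 + 1); split=> [|N N2 x [_ /= x1]]; first exact: num_real.
  by apply: le_trans (ltW N2); rewrite -[X in _ <= _ + X]x1; exact: norm_le_dot.
apply: (@closedI _ [set x : 'rV[R]_n | x *m B = 0] [set x | dot x x = 1]).
  rewrite (_ : [set x : 'rV[R]_n | x *m B = 0] =
      \bigcap_(j in [set: 'I_m]) [set x | (x *m B) 0 j = 0]).
    apply: closed_bigI => j _; apply: (@preimage_closed _ _ _ [set 0]).
      move=> x _; rewrite /continuous_at; under eq_fun do rewrite mxE.
      rewrite mxE; apply: (@cvg_sum R _ (nbhs x)) => i _.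
      by apply: cvgMl; exact: cvg_coord.
    exact: closed_eq.
  apply/seteqP; split => x /=; first by move=> xB j _ /=; rewrite xB mxE.
  by move=> xB; apply/rowP => j; rewrite xB // mxE.
apply: (@preimage_closed _ _ (fun x => dot x x) [set 1]); last exact: closed_eq.
move=> x _; rewrite /continuous_at -qform1; under eq_fun do rewrite -qform1.
exact: cvg_qform.
Qed.

(** The maximum is attained on the compact unit sphere of the kernel of [B], nonempty because of
    [x0]; homogeneity extends the bound to the whole kernel. *)
Lemma rayleigh m A (B : 'M[R]_(n, m)) x0 : x0 *m B = 0 -> x0 != 0 ->
  exists x, [/\ x *m B = 0, dot x x = 1 &
    forall y, y *m B = 0 -> qform A y y <= qform A x x * dot y y].
Proof.
move=> x0B x00.
have unit y : y *m B = 0 -> y != 0 -> exists z,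
   [/\ z *m B = 0, dot z z = 1 & qform A y y = qform A z z * dot y y].
  move=> yB y0; have yy := dot_gt0 _ y0.
  exists ((Num.sqrt (dot y y))^-1 *: y).
  rewrite -scalemxAl yB scaler0 dotZ qformZ exprVn sqr_sqrtr ?ltW //.
  by split=> //; field; rewrite gt_eqF.
have [z [zB zz _]] := unit _ x0B x00.
have [||x] := @EVT_max_rV R n (fun x => qform A x x) _ _ (compact_unit_sphere _ B).
- by exists z.
- by apply: continuous_subspaceT => x; exact: cvg_qform.
rewrite inE => -[xB xx] xmax; exists x; split => // y yB.
have [->|y0] := eqVneq y 0.
  by rewrite -[0](scale0r (0 : 'rV[R]_n)) qformZ dotZ expr0n !mul0r mulr0.
have [z' [z'B z'z' ->]] := unit _ yB y0.
by rewrite ler_wpM2r ?dot_ge0 //; apply: xmax; rewrite inE.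
Qed.

End QuadraticForms.

(** * Symmetric matrices with one positive eigenvalue *)

Section Eigenvalues.
Context {R : realType} {n : nat}.
Implicit Types (A : 'M[R]_n) (x y u e : 'rV[R]_n) (l : 'cV[R]_n).

(** The form [l] may be zero, and then the quadratic form is nonpositive everywhere: the condition
    stands for at most one positive eigenvalue. *)
Definition hyperplane_nonpos A : Prop :=
  exists l, forall x, linform l x = 0 -> qform A x x <= 0.

Section HyperplaneNonpos.
Variables (A : 'M[R]_n) (u : 'rV[R]_n).
Hypotheses (A_sym : A^T = A) (A_nonpos : hyperplane_nonpos A).
Hypothesis (u_pos : 0 < qform A u u).

(** Otherwise the quadratic form would be positive definite on the plane spanned by [x] and [u], yet
    this plane meets the kernel of [l]. *)
Lemma qform_orth_le0 x : qform A x u = 0 -> qform A x x <= 0.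
Proof.
case: A_nonpos => l lA xu; rewrite leNgt; apply/negP => x_pos.
have := lA (linform l u *: x + (- linform l x) *: u).
rewrite linform_comb linformZ qform_comb -[- _ *: u]addr0 !qform_comb !qform_combr.
have q0 y : qform A y 0 = 0 by rewrite /qform trmx0 mulmx0 mxE.
have q0' y : qform A 0 y = 0 by rewrite /qform !mul0mx mxE.
rewrite (qform_sym _ u x A_sym) xu !q0 !q0' => /(_ _)/wrap[]; first by ring.
have [lu0|lu0] := eqVneq (linform l u) 0.
  by move: (lA u lu0); rewrite leNgt u_pos.
rewrite (_ : _ + _ = linform l u ^+ 2 * qform A x x + linform l x ^+ 2 * qform A u u).
  apply/negP; rewrite -ltNge ltr_wpDr //.
    by rewrite mulr_ge0 ?sqr_ge0 // ltW.
  by rewrite mulr_gt0 // exprn_even_gt0.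
by ring.
Qed.

(** Reversed Cauchy-Schwarz inequality: apply [qform_orth_le0] to the component of [x] orthogonal to
    [u], scaled by [qform A u u] to avoid a division. *)
Lemma qform_CS x : qform A x x * qform A u u <= qform A x u ^+ 2.
Proof.
have q0 y : qform A y 0 = 0 by rewrite /qform trmx0 mulmx0 mxE.
have q0' y : qform A 0 y = 0 by rewrite /qform !mul0mx mxE.
have := qform_orth_le0 (qform A u u *: x + ((- qform A x u) *: u + 0)).
rewrite !(qform_comb, qform_combr) !q0 !q0' (qform_sym _ u x A_sym).
move=> /(_ _)/wrap[]; first by ring.
have := u_pos; set p := qform A u u; set r := qform A x u; set q := qform A x x.
move=> p0 H; have : p * (q * p - r ^+ 2) <= 0 by move: H; rewrite !expr2; lra.
by rewrite pmulr_rle0 // subr_le0.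
Qed.

(** The quadratic form is negative semidefinite on the orthogonal complement of [u], so an isotropic
    vector there lies in the radical. *)
Lemma qform_isotropic x y :
  qform A x u = 0 -> qform A x x = 0 -> qform A x y = 0.
Proof.
move=> xu xx.
have q0 z : qform A z 0 = 0 by rewrite /qform trmx0 mulmx0 mxE.
have q0' z : qform A 0 z = 0 by rewrite /qform !mul0mx mxE.
(* A multiple of the component of [y] orthogonal to [u]. At [t x + z] the quadratic form is affine
   in [t] and nonpositive, so its slope is zero. *)
pose z := qform A u u *: y + ((- qform A y u) *: u + 0).
have zu : qform A z u = 0 by rewrite /z !qform_comb q0'; ring.
have zx : qform A z x = qform A u u * qform A x y.
  by rewrite /z !qform_comb q0' (qform_sym _ u x) // xu (qform_sym _ y x) //; ring.
clearbody z; have H t : 2 * t * qform A z x + qform A z z <= 0.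
  have := qform_orth_le0 (t *: x + z).
  rewrite !(qform_comb, qform_combr) xu zu xx (qform_sym _ x z) //.
  by rewrite mulr0 addr0 => /(_ erefl); lra.
have : qform A z x = 0.
  apply/eqP; apply: contraT => c0.
  (* At this [t] the affine function would take the value 1. *)
  have := H ((1 - qform A z z) / (2 * qform A z x)).
  have -> : 2 * ((1 - qform A z z) / (2 * qform A z x)) * qform A z x = 1 - qform A z z.
    by field.
  by lra.
by rewrite zx => /eqP; rewrite mulf_eq0 gt_eqF //= => /eqP.
Qed.

End HyperplaneNonpos.

(* A maximiser of the Rayleigh quotient on the orthogonal complement of [B] is
   an eigenvector as soon as that complement is invariant. *)
Lemma rayleigh_eigen m A (B : 'M[R]_(n, m)) x : A^T = A ->
  x *m B = 0 -> x *m A *m B = 0 ->  dot x x = 1 ->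
  (forall y, y *m B = 0 -> qform A y y <= qform A x x * dot y y) ->
  x *m A = qform A x x *: x.
Proof.
move=> As xB xAB xx xmax; set a := qform A x x in xmax *.
have dotq y z : dot y z = qform 1%:M y z by rewrite /qform mulmx1.
apply/eqP; rewrite -subr_eq0; apply/eqP.
set z := x *m A - a *: x.
have zB : z *m B = 0 by rewrite mulmxBl xAB -scalemxAl xB scaler0 subrr.
have zE : dot z z = qform A x z - a * dot x z.
  by rewrite {1}/z /dot mulmxBl -scalemxAl [LHS]mxE [X in _ + X]mxE [X in - X]mxE.
(* Variation of the Rayleigh quotient from [x] in the direction of the residual [z]. *)
clearbody z; have H t : 2 * t * dot z z + t ^+ 2 * (qform A z z - a * dot z z) <= 0.
  have := xmax (t *: z + x); rewrite mulmxDl -scalemxAl zB xB scaler0 addr0.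
  move/(_ erefl); rewrite !dotq !(qform_comb, qform_combr) -!dotq xx.
  rewrite (qform_sym _ z x) // (dotC z x) -/a zE; lra.
apply/dot_eq0/eqP; apply: contraT => zz0.
have zz : 0 < dot z z by rewrite lt_neqAle eq_sym zz0 dot_ge0.
set c := qform A z z - a * dot z z in H.
have c1 : 0 < 1 + `|c| by rewrite ltr_pwDl.
(* For so small a [t] the linear term outweighs the quadratic one, whatever the sign of [c]. *)
have := H (dot z z / (1 + `|c|)).
rewrite (_ : _ + _ = (dot z z / (1 + `|c|)) ^+ 2 * (2 + 2 * `|c| + c)); last first.
  by field; rewrite gt_eqF.
rewrite leNgt mulr_gt0 // ?exprn_gt0 ?divr_gt0 //.
have := ler_norm (- c); rewrite normrN; lra.
Qed.

(** The hyperplane is the orthogonal complement of the positive eigenvector [e]. Were the form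
    positive somewhere on it, a Rayleigh maximiser there would be an eigenvector with positive
    eigenvalue, necessarily [a], hence a multiple of [e] although orthogonal to [e]. *)
Lemma one_positive_hyperplane A : A^T = A ->
  one_positive_eigenvalue A -> hyperplane_nonpos A.
Proof.
move=> As [a [a0 eA rE amax]].
have /eigenvalueP[e eAe e0] := eA.
exists e^T => x0 x0e; rewrite leNgt; apply/negP => x0_pos.
have x00 : x0 != 0.
  by apply: contraTneq x0_pos => ->; rewrite /qform !mul0mx mxE ltxx.
have x0e' : x0 *m e^T = 0 by apply/matrixP => i j; rewrite !ord1 [RHS]mxE.
have [x [xe xx xmax]] := rayleigh _ A (e^T) x0 x0e' x00.
have xAe : x *m A *m e^T = 0.
  rewrite -mulmxA (_ : A *m e^T = a *: e^T) -?scalemxAr ?xe ?scaler0 //.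
  by rewrite -[A in LHS]As -trmx_mul eAe linearZ.
have := rayleigh_eigen _ A e^T x As xe xAe xx xmax.
set b := qform A x x => xAx; have b0 : 0 < b.
  have := xmax _ x0e'; have := dot_gt0 _ x00; rewrite -/b; nra.
have x_nz : x != 0.
  by apply: contra_eq_neq xx => ->; rewrite /dot mul0mx mxE eq_sym oner_neq0.
have ab : b = a by apply: amax => //; apply/eigenvalueP; exists x.
have eE : (e <= eigenspace A a)%MS by apply/eigenspaceP.
have xE : (x <= eigenspace A a)%MS by apply/eigenspaceP; rewrite -ab.
have re : \rank e = 1%N by rewrite rank_rV e0.
have Ee : (eigenspace A a <= e)%MS.
  by rewrite -(geq_leqif (mxrank_leqif_sup eE)) rE re.
have /sub_rVP[c xc] := submx_trans xE Ee.
have : dot x x = 0.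
  rewrite {2}xc /dot linearZ /= -scalemxAr mxE.
  by rewrite xe mxE mulr0.
by rewrite xx => /eqP; rewrite oner_eq0.
Qed.

(** A global Rayleigh maximiser [e] has a positive eigenvalue. By [qform_orth_le0] no nonzero vector
    orthogonal to [e] is an eigenvector with positive eigenvalue, which yields both multiplicity one
    and uniqueness. *)
Lemma hyperplane_one_positive A u : A^T = A ->
  hyperplane_nonpos A -> 0 < qform A u u -> one_positive_eigenvalue A.
Proof.
move=> As hA u0.
have u_nz : u != 0.
  by apply: contraTneq u0 => ->; rewrite /qform !mul0mx mxE ltxx.
(* The zero matrix imposes no constraint: the maximum is taken over the whole space. *)
pose B : 'cV[R]_n := 0.
have [e [_ ee emax]] := rayleigh _ A B u (mulmx0 _ _) u_nz.
have := rayleigh_eigen _ A B e As (mulmx0 _ _) (mulmx0 _ _) ee emax.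
set a := qform A e e => eAe.
have a0 : 0 < a.
  have := emax _ (mulmx0 _ _); move=> /(_ u) ; have := dot_gt0 _ u_nz; rewrite -/a; nra.
have e_nz : e != 0.
  by apply: contra_eq_neq ee => ->; rewrite /dot mul0mx mxE eq_sym oner_neq0.
have orth b y : 0 < b -> y *m A = b *: y -> dot y e = 0 -> y = 0.
  move=> b0 yA ye; apply/dot_eq0/eqP; rewrite eq_le dot_ge0 andbT.
  have := qform_orth_le0 A e As hA a0 y.
  have yAz z : qform A y z = b * dot y z by rewrite /qform yA -scalemxAl mxE.
  by rewrite !yAz ye mulr0 pmulr_rle0 // => ->.
have eE : (e <= eigenspace A a)%MS by apply/eigenspaceP.
exists a; split => //; first by apply/eigenvalueP; exists e.
  have : (eigenspace A a <= e)%MS.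
    apply/rV_subP => y /eigenspaceP yA; apply/sub_rVP; exists (dot y e).
    apply/eqP; rewrite -subr_eq0; apply/eqP; apply: (orth a) => //.
      by rewrite mulmxBl yA -scalemxAl eAe scalerBr !scalerA mulrC.
    by rewrite addrC -scaleNr dot_comb ee mulr1 addNr.
  move=> /mxrankS; have := mxrankS eE; rewrite rank_rV e_nz => le1 le2.
  by apply/eqP; rewrite eqn_leq le1 le2.
move=> b b0 /eigenvalueP[y yA y_nz]; apply/eqP; apply: contraT => ba.
case/eqP: y_nz; apply: (orth b) => //.
have : qform A y e = a * dot y e.
  by rewrite qform_sym // /qform eAe -scalemxAl mxE dotC.
rewrite /qform yA -scalemxAl mxE -/(dot y e) => /eqP.
by rewrite -subr_eq0 -mulrBl mulf_eq0 subr_eq0 (negPf ba) => /eqP.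
Qed.

End Eigenvalues.

(** * Open convex cones and their closures *)

Section OpenCones.
Context {R : realType} {n : nat} (K : set 'rV[R]_n).
Hypotheses (K_open : open K) (K_convex : convex_set K) (K_cone : is_cone K).
Implicit Types (u w x : 'rV[R]_n).

Lemma coneD u w : K u -> K w -> K (u + w).
Proof.
move=> Ku Kw; have [h0 h1] : 0 <= (2^-1 : R) /\ (2^-1 : R) <= 1 by split; lra.
have Kconv : K (2^-1 *: u + (1 - 2^-1) *: w).
  by have := K_convex u w (Itv01 h0 h1); rewrite !inE; apply.
have := K_cone 2 _ (ltr0Sn _ 1) Kconv.
rewrite scalerDr !scalerA divff ?pnatr_eq0 // scale1r.
by rewrite (_ : 2 * (1 - 2^-1) = 1) ?scale1r //; field.
Qed.

Lemma cone_perturb u w : K u -> exists2 e, 0 < e & K (u + e *: w).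
Proof.
move=> Ku; have : (fun e : R => u + e *: w) @ 0^'+ --> u.
  apply: cvg_at_right_filter; rewrite -[X in _ --> X]addr0 -(scale0r w).
  apply: cvgD; first exact: cvg_cst.
  by apply: cvgZr_tmp => //; exact: cvg_id.
move=> /(_ K (open_nbhs_nbhs (conj K_open Ku))) Kn.
have /filter_ex[e [/= e0 Ke]] : \forall e \near (0 : R)^'+, 0 < e /\ K (u + e *: w).
  near=> e; split; first by near: e; exact: nbhs_right_gt.
  by near: e.
by exists e.
Unshelve. all: by end_near. Qed.

(** As [z] in [K] tends to [w], the vector [u + w - z] tends to [u] and enters the open cone; adding
    [z] back stays in the cone. *)
Lemma coneD_closure u w : K u -> closure K w -> K (u + w).
Proof.
move=> Ku Kw; have : (fun z => u + w - z) @ w --> u.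
  rewrite -[X in _ --> X](addrK w); apply: (@cvgB _ _ _ (nbhs w) _ (fun=> u + w) id).
    exact: (@cvg_cst _ (u + w) _ (nbhs w)).
  exact: cvg_id.
move=> /(_ K (open_nbhs_nbhs (conj K_open Ku))) /Kw[z [Kz /= Kuwz]].
by rewrite -(subrK z (u + w)); apply: coneD.
Qed.

End OpenCones.

(** * Lorentzian forms and the common kernel of their Hessians *)

Section Lorentzian.
Context {R : realType} {n : nat} (K : set 'rV[R]_n) (v : 'rV[R]_n).
Hypotheses (K_open : open K) (K_convex : convex_set K) (K_cone : is_cone K).
Hypothesis (Kv : K v).
Implicit Types (f g : mpoly n R) (u w x y : 'rV[R]_n) (us vs : seq 'rV[R]_n).
Implicit Types (l : 'cV[R]_n).

Local Notation inK us := (forall u, u \in us -> K u).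

Lemma qform_hessian vs f x y :
  qform (hessian (dirDs vs f)) x y = polar (x :: y :: vs) f.
Proof. exact: hessian_polar. Qed.

(** Phrased for plain polynomials, so that operators apply without rebuilding elements of [dhomog].
    The last clause is vacuous for [d < 2]. *)
Definition lorentzian d f : Prop :=
  [/\ homog d f,
      forall us, size us = d -> inK us -> 0 < polar us f &
      forall vs, (size vs).+2 = d -> inK vs ->
        hyperplane_nonpos (hessian (dirDs vs f))].

Lemma inK_cons u us : K u -> inK us -> inK (u :: us).
Proof. by move=> Ku Kus x; rewrite inE => /predU1P[->|/Kus]. Qed.

Lemma LorentzianP d (f : dhomog n R d) :
  Lorentzian K d f <-> lorentzian d f.
Proof.
split=> [Lf|[_ P_pos P_hess] us Kus].
  have tupK us (us_d : size us == d) : inK us -> forall i, K (tnth (Tuple us_d) i).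
    by move=> Kus i; apply: Kus; exact: mem_tnth.
  split; first exact: dhomog_is_dhomog.
    by move=> us /eqP us_d Kus; have [] := Lf (Tuple us_d) (tupK _ _ Kus).
  (* [Lorentzian] drops the first two directions of the tuple, so [vs] is padded with two copies of
     [v]. *)
  move=> vs /eqP vs_d Kvs; have vs_d' : size (v :: v :: vs) == d by [].
  have [|_ h] := Lf (Tuple vs_d').
    by apply: tupK; apply: inK_cons => //; apply: inK_cons.
  apply: one_positive_hyperplane; first exact: hessian_sym.
  by rewrite -(drop0 vs); apply: h; rewrite -(eqP vs_d).
have Kus' : inK us by move=> u /tnthP[i ->].
split=> [|d2]; first by apply: P_pos => //; exact: size_tuple.
have Kd : inK (drop 2 us) by move=> u /mem_drop; exact: Kus'.
have sd : (size (drop 2 us)).+2 = d.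
  by rewrite size_drop size_tuple -[RHS](subnKC d2).
apply: (hyperplane_one_positive _ v); [exact: hessian_sym|exact: P_hess|].
rewrite qform_hessian; apply: P_pos => //.
by apply: inK_cons => //; apply: inK_cons.
Qed.

(** By multilinearity: [K] being open, each [u] is a combination of [v] and some [v + e u], both in
    [K]. *)
Lemma polar_eq0_extend k g :
  (forall us, size us = k -> inK us -> polar us g = 0) ->
  forall us, size us = k -> polar us g = 0.
Proof.
elim: k g => [|k IH] g P0 [|u us] //= => [_|[us_k]]; first exact: P0.
have [e e0 Ke] := cone_perturb K K_open v u Kv.
have P0K w : K w -> polar (w :: us) g = 0.
  move=> Kw; rewrite polar_cons; apply: IH => // ws ws_k Kws.
  by rewrite -polar_cons P0 /= ?ws_k //; exact: inK_cons.
have := P0K _ Ke; rewrite addrC polar_comb (P0K v) // addr0 => /eqP.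
by rewrite mulf_eq0 gt_eqF //= => /eqP.
Qed.

Section LorentzianForm.
Variables (d : nat) (f : mpoly n R).
Hypothesis f_lor : lorentzian d f.

Let P_pos us : size us = d -> inK us -> 0 < polar us f.
Proof. by case: f_lor => _ + _; apply. Qed.

Lemma lorentzian_orth_le0 u vs x : (size vs).+2 = d -> K u -> inK vs ->
  polar [:: x, u & vs] f = 0 -> polar [:: x, x & vs] f <= 0.
Proof.
move=> vs_d Ku Kvs; rewrite -!qform_hessian => xu.
apply: qform_orth_le0 xu; [exact: hessian_sym|by case: f_lor => _ _; apply|].
by rewrite qform_hessian; apply: P_pos => //; apply: inK_cons => //; apply: inK_cons.
Qed.

Lemma lorentzian_CS u vs x : (size vs).+2 = d -> K u -> inK vs ->
  polar [:: x, x & vs] f * polar [:: u, u & vs] f <= polar [:: x, u & vs] f ^+ 2.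
Proof.
move=> vs_d Ku Kvs; rewrite -!qform_hessian.
apply: qform_CS; [exact: hessian_sym|by case: f_lor => _ _; apply|].
by rewrite qform_hessian; apply: P_pos => //; apply: inK_cons => //; apply: inK_cons.
Qed.

Lemma lorentzian_isotropic u vs x y : (size vs).+2 = d -> K u -> inK vs ->
  polar [:: x, u & vs] f = 0 -> polar [:: x, x & vs] f = 0 ->
  polar [:: x, y & vs] f = 0.
Proof.
move=> vs_d Ku Kvs; rewrite -!qform_hessian => xu xx.
apply: qform_isotropic xu xx; [exact: hessian_sym|by case: f_lor => _ _; apply|].
by rewrite qform_hessian; apply: P_pos => //; apply: inK_cons => //; apply: inK_cons.
Qed.

(** The value [polar [:: x, x, w & vs] f] is linear in [w], nonpositive on [K] and zero at [u]. As
    [u] is interior it vanishes on [K], so [x] is isotropic for the Hessian at [w :: vs], and also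
    orthogonal to [u]. *)
Lemma kernel_exchange u w vs x : (size vs).+3 = d -> K u -> K w -> inK vs ->
  (forall y, polar [:: x, y, u & vs] f = 0) ->
  forall y, polar [:: x, y, w & vs] f = 0.
Proof.
move=> vs_d Ku Kw Kvs xu0 y.
have swap23 a b c us : polar [:: a, b, c & us] f = polar [:: a, c, b & us] f.
  by rewrite /polar /= (dirDC b).
have xxw z : K z -> polar [:: x, x, z & vs] f <= 0.
  move=> Kz; apply: (lorentzian_orth_le0 u) => //; first exact: inK_cons.
  by rewrite swap23.
have rot3 z : polar [:: x, x, z & vs] f = polar [:: z, x, x & vs] f.
  by rewrite swap23 polar_swap.
apply: (lorentzian_isotropic u) => //; first exact: inK_cons.
  by rewrite swap23.
apply/eqP; rewrite eq_le xxw //=.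
have [e e0 Ke] := cone_perturb K K_open u (- w) Ku.
have := xxw _ Ke; rewrite rot3 addrC polar_comb -rot3 -(rot3 u) xu0 addr0.
by rewrite -scaleN1r -[_ *: w]addr0 rot3 polar_comb polar0l -rot3; nra.
Qed.

(** Exchanging the directions of [vs] one at a time shows that all Hessians at directions in [K]
    have the same kernel, so every polarisation of [dirD x f] vanishes. *)
Lemma kernel_lineality vs x : (size vs).+2 = d -> inK vs ->
  (forall y, polar [:: x, y & vs] f = 0) -> dirD x f = 0.
Proof.
move=> vs_d Kvs x0.
(* [pre] collects the directions already exchanged. *)
have exch pre ws us : size ws = size us -> (size (pre ++ us)).+2 = d ->
    inK pre -> inK ws -> inK us ->
    (forall y, polar [:: x, y & pre ++ us] f = 0) ->
    forall y, polar [:: x, y & pre ++ ws] f = 0.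
  elim: ws us pre => [|w ws IH] [|u us] pre //= [ws_us] pre_d Kpre Kws Kus xy0.
  have Kw : K w by apply: Kws; rewrite mem_head.
  have Ku : K u by apply: Kus; rewrite mem_head.
  have Kus' : inK us by move=> z zus; apply: Kus; rewrite inE zus orbT.
  have Kws' : inK ws by move=> z zus; apply: Kws; rewrite inE zus orbT.
  rewrite -cat_rcons; apply: (IH us) => //.
  - by rewrite cat_rcons !size_cat /= -pre_d size_cat.
  - by move=> z; rewrite mem_rcons; exact: inK_cons.
  have perm y z : polar [:: x, y & rcons pre z ++ us] f =
      polar [:: x, y, z & pre ++ us] f.
    by apply: polar_perm; rewrite !perm_cons cat_rcons -cat1s perm_catCA.
  move=> y; rewrite perm; apply: (kernel_exchange u) => //.
  - by rewrite -pre_d !size_cat /= addnS.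
  - by move=> z; rewrite mem_cat => /orP[/Kpre|/Kus'].
  by move=> z; rewrite -perm cat_rcons.
have hf : homog d f by case: f_lor.
have d1 : d = d.-1.+1 by rewrite -vs_d.
apply: (homog_polar_eq0 d.-1); first by apply: homog_dirD; rewrite -d1.
apply: polar_eq0_extend => -[|y us] us_d Kus.
  by move: us_d; rewrite -vs_d.
rewrite -polar_cons; apply: (exch [::] us vs) => //.
  by move: us_d => /=; rewrite -vs_d => -[].
by move=> z zus; apply: Kus; rewrite inE zus orbT.
Qed.

(** For every [a > 0] both [a v + w] and [a v - w] lie in [K], so the polarisation at [w] is smaller
    in absolute value than [a] times the one at [v]. *)
Lemma lorentzian_lineality w : (0 < d)%N -> lineality K w -> dirD w f = 0.
Proof.
move=> d0 [Kw KNw]; have hf : homog d f by case: f_lor.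
have d1 : d = d.-1.+1 by rewrite prednK.
apply: (homog_polar_eq0 d.-1); first by apply: homog_dirD; rewrite -d1.
apply: polar_eq0_extend => us us_d Kus; rewrite -polar_cons.
have line (a : R) : 0 < a -> a * polar (v :: us) f + polar (w :: us) f > 0
    /\ a * polar (v :: us) f - polar (w :: us) f > 0.
  move=> a0; have posD z : closure K z -> 0 < a * polar (v :: us) f + polar (z :: us) f.
    move=> Kz; rewrite -polar_comb; apply: P_pos; first by rewrite /= us_d.
    by apply: inK_cons => //; apply: coneD_closure => //; exact: K_cone.
  split; first exact: posD.
  by have := posD _ KNw; rewrite -scaleN1r polarZl mulN1r.
have p0 : 0 < polar (v :: us) f.
  by apply: P_pos; [rewrite /= us_d|exact: inK_cons].
apply/eqP; apply: contraT => c0; have c1 : 0 < `|polar (w :: us) f| by rewrite normr_gt0.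
(* For this [a] one of the two strict inequalities reads [0 < 0]. *)
have [] := line (`|polar (w :: us) f| / polar (v :: us) f) (divr_gt0 c1 p0).
rewrite divfK ?gt_eqF //; case: (leP 0 (polar (w :: us) f)) => h.
  by rewrite ger0_norm // subrr ltxx.
by rewrite ltr0_norm // addNr ltxx.
Qed.

End LorentzianForm.

End Lorentzian.

(** * Two operators on forms: [nuij] and the pullback by a contraction *)

Section Operators.
Context {R : realType} {n : nat} (v : 'rV[R]_n).
Implicit Types (f g : mpoly n R) (u w x y : 'rV[R]_n) (us vs : seq 'rV[R]_n).
Implicit Types (l : 'cV[R]_n) (a b s : R).

Definition nuij a b l f : mpoly n R := a *: f + b *: (linpoly l * dirD v f).

Lemma polar_nuij a b l us f : polar us (nuij a b l f) = a * polar us f +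
  b * \sum_(i < size us) linform l (nth 0 us i) * polar (v :: remove_nth i us) f.
Proof.
rewrite /nuij linearD /= !polarZ polar_linpolyM; congr (_ + _ * _).
by apply: eq_bigr => i _; rewrite polar_cons.
Qed.

Lemma homog_nuij d a b l f : (0 < d)%N -> homog d f -> homog d (nuij a b l f).
Proof.
case: d => // d _ hf; apply: rpredD; apply: rpredZ => //.
by apply: homog_linpolyM; exact: homog_dirD.
Qed.

(** Sorts the Leibniz terms according to whether [linpoly l] is differentiated along [x], along [y]
    or along a member of [vs]. *)
Lemma polar_nuij2 a b l x y vs f : polar [:: x, y & vs] (nuij a b l f) =
  a * polar [:: x, y & vs] f +
  b * (linform l x * polar [:: v, y & vs] f + linform l y * polar [:: x, v & vs] f +
    \sum_(i < size vs) linform l (nth 0 vs i) * polar [:: x, y, v & remove_nth i vs] f).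
Proof.
rewrite polar_nuij !big_ord_recl /= {1 2}/remove_nth /= !drop0.
rewrite (polar_swap v x) addrA; congr (_ + _ * (_ + _)).
apply: eq_bigr => i _; rewrite /bump /= !add1n /=; congr (_ * _).
apply: polar_perm; rewrite /remove_nth /=.
by apply/permP => p /=; rewrite addnCA; congr addn; exact: addnCA.
Qed.

Lemma polar_nuij_nseq a b l k x y f : linform l v = 1 ->
  polar [:: x, y & nseq k v] (nuij a b l f) =
  (a + b * k%:R) * polar [:: x, y & nseq k v] f +
  b * (linform l x * polar [:: v, y & nseq k v] f
       + linform l y * polar [:: x, v & nseq k v] f).
Proof.
move=> lv; rewrite polar_nuij2 size_nseq.
have -> : \sum_(i < k) linform l (nth 0 (nseq k v) i) *
    polar [:: x, y, v & remove_nth i (nseq k v)] f =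
    k%:R * polar [:: x, y & nseq k v] f; last by ring.
rewrite -[k in k%:R]card_ord -sumr_const mulr_suml; apply: eq_bigr => i _.
have ik : (i < size (nseq k v))%N by rewrite size_nseq.
rewrite nth_nseq ltn_ord lv; congr (_ * _); apply: polar_perm.
rewrite !perm_cons perm_sym.
by have := perm_remove_nth _ _ ik; rewrite nth_nseq ltn_ord.
Qed.

Lemma polar_nuij_diag a b l d f : linform l v = 1 ->
  polar (nseq d v) (nuij a b l f) = (a + b * d%:R) * polar (nseq d v) f.
Proof.
move=> lv; rewrite polar_nuij size_nseq mulrDl -mulrA; congr (_ + _ * _).
rewrite -[d in d%:R]card_ord -sumr_const mulr_suml; apply: eq_bigr => i _.
have id : (i < size (nseq d v))%N by rewrite size_nseq.
rewrite nth_nseq ltn_ord lv; congr (_ * _); apply: polar_perm.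
by rewrite perm_sym; have := perm_remove_nth _ _ id; rewrite nth_nseq ltn_ord.
Qed.

Definition contr_mx s l : 'M[R]_n := (1 - s)%:M + s *: (l *m v).

Lemma mul_contr_mx s l x :
  x *m contr_mx s l = (1 - s) *: x + (s * linform l x) *: v.
Proof.
rewrite /contr_mx mulmxDr mul_mx_scalar -scalemxAr mulmxA -scalerA; congr (_ + _ *: _).
by rewrite [x *m l]mx11_scalar mul_scalar_mx.
Qed.

(* The pullback of the [d]-form [f] by [contr_mx s l], as a Taylor expansion
   along [v]. *)
Definition contract_form d s l f : mpoly n R :=
  \sum_(k < d.+1) ((1 - s) ^+ (d - k) * s ^+ k / k`!%:R) *:
    (linpoly l ^+ k * dirDs (nseq k v) f).

(** The truncated exponent [k.-1] is harmless at [k = 0], where its factor is zero. *)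
Lemma dirD_linpoly_exp u k l g : dirD u (linpoly l ^+ k * g) =
  (k%:R * linform l u) *: (linpoly l ^+ k.-1 * g) + linpoly l ^+ k * dirD u g.
Proof.
elim: k g => [|k IH] g; first by rewrite !expr0 !mul1r mul0r scale0r add0r.
rewrite exprS -mulrA dirD_linpolyM IH mulrDr addrA -!mulrA; congr (_ + _).
case: k IH => [|k] IH /=.
  by rewrite mul0r scale0r mulr0 addr0 (mul1r (linform l u)).
rewrite -scalerAr mulrA -exprS -scalerDl; congr (_ *: _); rewrite -[in RHS]natr1; ring.
Qed.

(** Chain rule for the pullback. In each Taylor term the derivative falls on the power of
    [linpoly l] or on the derivative of [f]; shifting the index in the former terms matches both
    sums with the right-hand side. *)
Lemma contract_dirD d s l u f : homog d.+1 f ->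
  dirD u (contract_form d.+1 s l f) = contract_form d s l (dirD (u *m contr_mx s l) f).
Proof.
move=> hf; rewrite mul_contr_mx dirD_comb dirDZl.
have E1 : dirD u (contract_form d.+1 s l f) =
   \sum_(k < d.+2) ((1 - s) ^+ (d.+1 - k) * s ^+ k / k`!%:R) *:
    (linpoly l ^+ k * dirDs (nseq k v) (dirD u f)) +
   \sum_(k < d.+2) ((1 - s) ^+ (d.+1 - k) * s ^+ k / k`!%:R) *:
    ((k%:R * linform l u) *: (linpoly l ^+ k.-1 * dirDs (nseq k v) f)).
  rewrite (raddf_sum (dirD u)) -big_split; apply: eq_bigr => k _ /=.
  by rewrite dirDZ dirD_linpoly_exp scalerDr addrC dirDs_dirD.
(* The top term takes [d + 2] derivatives of a form of degree [d + 1]. *)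
rewrite {}E1 big_ord_recr /= [X in _ *: (_ * X)](_ : _ = 0); last first.
  rewrite dirDs_dirD dirDC homog0_dirD //.
  by apply: (homog_dirDs 0%N (nseq d.+1 v)); rewrite size_nseq.
(* The term [k = 0] of the second sum carries the factor zero. *)
rewrite mulr0 scaler0 addr0 [X in _ + X = _]big_ord_recl.
rewrite mul0r scale0r scaler0 add0r -[LHS]big_split /=.
rewrite /contract_form; apply: eq_bigr => k _.
rewrite (linearD (dirDs _)) !(linearZ_LR (dirDs _)) /= mulrDr scalerDr.
rewrite -!scalerAr !scalerA; congr (_ *: _ + _ *: (_ * _)).
- by rewrite subSn ?exprS; [ring|rewrite -ltnS].
- rewrite /bump /= add1n subSS factS natrM exprS. field.
  by rewrite nat1r !pnatr_eq0 -lt0n fact_gt0.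
- by rewrite /bump /= dirDs_dirD.
Qed.

Lemma homog_linpolyX k l : homog k (linpoly l ^+ k : mpoly n R).
Proof.
elim: k => [|k IH]; first by rewrite expr0; exact: dhomog1.
by rewrite exprS; exact: homog_linpolyM.
Qed.

Lemma homog_contract d s l f : homog d f -> homog d (contract_form d s l f).
Proof.
move=> hf; apply: rpred_sum => k _; apply: rpredZ.
have kd : (k <= d)%N by rewrite -ltnS.
have : homog (k + (d - k))%N (linpoly l ^+ k * dirDs (nseq k v) f).
  apply: dhomogM; first exact: homog_linpolyX.
  by apply: homog_dirDs; rewrite size_nseq subnK.
by rewrite subnKC.
Qed.

Lemma polar_contract d s l f us : homog d f -> size us = d ->
  polar us (contract_form d s l f) = polar [seq u *m contr_mx s l | u <- us] f.
Proof.
elim: us d f => [|u us IH] d f + us_d; rewrite -us_d => hf.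
  by rewrite /contract_form big_ord1 /= subnn !expr0 !mul1r fact0 invr1 scale1r.
rewrite /= !polar_cons contract_dirD //; apply: IH => //.
exact: homog_dirD.
Qed.

Lemma contract_form0 d l f : contract_form d 0 l f = f.
Proof.
rewrite /contract_form big_ord_recl big1 ?addr0 => [|k _].
  by rewrite subr0 !expr0 expr1n !mul1r invr1 scale1r.
by rewrite expr0n /= mulr0 mul0r scale0r.
Qed.

(** Only the term [k = d] survives, the others containing a positive power of [1 - 1]. *)
Lemma contract_form1 d l f : homog d f ->
  contract_form d 1 l f = (polar (nseq d v) f / d`!%:R) *: linpoly l ^+ d.
Proof.
move=> hf; rewrite /contract_form big_ord_recr big1 ?add0r => [|k _] /=.
  rewrite subnn expr0 expr1n mul1r (homog0_const (dirDs _ f)).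
    by rewrite [_ ^+ d * _]mulrC mul_mpolyC scalerA mul1r (mulrC _^-1) add0r.
  by apply: (homog_dirDs 0%N); rewrite size_nseq.
by rewrite subrr expr0n subn_eq0 leqNgt ltn_ord /= !mul0r scale0r.
Qed.

Lemma polar_linpolyX k l us : size us = k ->
  polar us (linpoly l ^+ k : mpoly n R) = k`!%:R * \prod_(u <- us) linform l u.
Proof.
elim: us k => [|u us IH] k <- /=.
  by rewrite big_nil mulr1 expr0 /polar /= mcoeff1 eqxx.
rewrite polar_cons -[_ ^+ _]mulr1 dirD_linpoly_exp.
rewrite -mpolyC1 homog0_dirD ?mulr0 ?addr0; last by rewrite mpolyC1 dhomog1.
rewrite mpolyC1 mulr1 polarZ IH // big_cons factS natrM; ring.
Qed.

End Operators.

(** * Both operators preserve Lorentzian forms *)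

Section OperatorsLorentzian.
Context {R : realType} {n : nat} (K : set 'rV[R]_n) (v : 'rV[R]_n).
Hypotheses (K_open : open K) (K_convex : convex_set K) (K_cone : is_cone K).
Hypothesis (Kv : K v).
Implicit Types (f g : mpoly n R) (u w x y : 'rV[R]_n) (us vs : seq 'rV[R]_n).
Implicit Types (l : 'cV[R]_n) (a b s : R).

(* On the hyperplane [polar [:: x, v & vs] f = 0] every term of the Hessian of
   [nuij a b l f] is either zero or a nonpositive form. *)
Lemma lorentzian_nuij d a b l f : (0 < d)%N -> 0 < a -> 0 <= b ->
  (forall u, K u -> 0 <= linform l u) ->
  lorentzian K d f -> lorentzian K d (nuij v a b l f).
Proof.
move=> d0 a0 b0 l0 f_lor; have [hf f_pos _] := f_lor.
split=> [|us us_d Kus|vs vs_d Kvs]; first exact: homog_nuij.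
  rewrite polar_nuij ltr_pwDl ?mulr_gt0 ?f_pos //.
  rewrite mulr_ge0 // sumr_ge0 // => i _; rewrite mulr_ge0 //.
    by apply/l0/Kus/mem_nth.
  apply/ltW/f_pos; first by rewrite /= size_remove_nth // us_d prednK.
  by apply: inK_cons => // u /mem_remove_nth/Kus.
exists (hessian (dirDs vs f) *m v^T) => x.
rewrite /linform mulmxA -/(qform _ x v) !qform_hessian => xv.
rewrite polar_nuij2 (polar_swap v x) xv !mulr0 addr0 add0r.
rewrite -[leRHS]addr0 lerD //.
  by rewrite pmulr_rle0 //; apply: (lorentzian_orth_le0 K d f f_lor v).
rewrite mulr_ge0_le0 // sumr_le0 // => i _; rewrite mulr_ge0_le0 //.
  by apply/l0/Kvs/mem_nth.
(* The Hessian here is the one at [v] and the other members of [vs]; by the choice of hyperplane [x]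
   is orthogonal for it to the removed member. *)
have Ki : K (nth 0 vs i) by apply/Kvs/mem_nth.
apply: (lorentzian_orth_le0 K d f f_lor (nth 0 vs i)) => //.
- by rewrite /= size_remove_nth // prednK // (leq_ltn_trans _ (ltn_ord i)).
- by apply: inK_cons => // u /mem_remove_nth/Kvs.
rewrite -xv; apply: polar_perm; rewrite perm_cons.
have /= -> := perm_catCA [:: nth 0 vs i] [:: v] (remove_nth i vs).
by rewrite perm_cons perm_sym; exact: perm_remove_nth.
Qed.

(** Test the kernel condition against [v] and [x], all other directions being [v]. With
    [lorentzian_CS] the two equations force [polar [:: x, v & vs] f = 0], then [linform l x = 0],
    and then [x] lies in the kernel of the Hessian of [f]. *)
Lemma nuij_kernel d a b l f x : (1 < d)%N -> 0 < a -> 0 < b -> linform l v = 1 ->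
  lorentzian K d f -> dirD x (nuij v a b l f) = 0 ->
  linform l x = 0 /\ dirD x f = 0.
Proof.
case: d => [|[|k]] // _ a0 b0 lv f_lor xT; set vs := nseq k v.
have Kvs u : u \in vs -> K u by move=> /nseqP[->].
have vs_k : (size vs).+2 = k.+2 by rewrite size_nseq.
have T0 y : (a + b * k%:R) * polar [:: x, y & vs] f + b * (linform l x *
   polar [:: v, y & vs] f + linform l y * polar [:: x, v & vs] f) = 0.
  by rewrite -polar_nuij_nseq // polar_cons xT linear0.
have CS := lorentzian_CS K k.+2 f f_lor v vs x vs_k Kv Kvs.
have p0 : 0 < polar [:: v, v & vs] f.
  case: f_lor => _ + _; apply; first by rewrite /= vs_k.
  by apply: inK_cons => //; exact: inK_cons.
have c0 : 0 < a + b * k%:R by rewrite ltr_pwDl // mulr_ge0 // ltW.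
have Tv := T0 v; have Tx := T0 x; rewrite lv mul1r in Tv.
rewrite (polar_swap v x) in Tx.
move: (a + b * k%:R) c0 T0 Tv Tx => c c0 T0.
set r := polar [:: x, v & vs] f in CS *.
set q := polar [:: x, x & vs] f in CS *.
set p := polar [:: v, v & vs] f in CS p0 *.
set m := linform l x => Tv Tx.
have rE : (c + b) * r = - (b * m * p) by lra.
have cb : 0 < c + b by lra.
(* Eliminates [m] from [(c + b) r = - b m p] and [c q = - 2 b m r]. Against [q p <= r ^ 2] this
   leaves [(c + 2 b) r ^ 2 <= 0]. *)
have : c * (q * p) * (c + b) = 2 * (r ^+ 2 * (c + b) ^+ 2).
  have -> : c * (q * p) * (c + b) = - 2 * b * m * r * p * (c + b).
    rewrite (_ : c * (q * p) = (c * q) * p); last by ring.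
    by rewrite (_ : c * q = - (b * (m * r + m * r))); [ring|lra].
  rewrite expr2 expr2 (_ : _ * _ * _ = (r * (c + b)) * ((c + b) * r)); last by ring.
  by rewrite rE; ring.
move=> E; have r0 : r = 0.
  apply/eqP; rewrite -sqrf_eq0 eq_le sqr_ge0 andbT -(pmulr_lle0 _ cb).
  rewrite -(pmulr_lle0 _ cb).
  have : c * (q * p) * (c + b) <= c * r ^+ 2 * (c + b).
    apply: ler_wpM2r; first exact: ltW.
    by apply: ler_wpM2l => //; exact: ltW.
  rewrite E; have := sqr_ge0 r; set t := r ^+ 2 => t0.
  have : 0 <= t * (c + b) * b by do 2?[apply: mulr_ge0] => //; exact: ltW.
  by nra.
have m0 : m = 0.
  move: rE; rewrite r0 mulr0 => /esym/eqP; rewrite oppr_eq0 !mulf_eq0.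
  by rewrite (gt_eqF b0) (gt_eqF p0) orbF /= => /eqP.
split=> //; apply: (kernel_lineality K v _ _ k.+2 f f_lor vs) => // y.
have := T0 y; rewrite -/m -/r m0 r0 mul0r mulr0 addr0 mulr0 addr0 => /eqP.
by rewrite mulf_eq0 gt_eqF //= => /eqP.
Qed.

Lemma lorentzian_contract d s l f :
  (forall u, K u -> K (u *m contr_mx v s l)) ->
  lorentzian K d f -> lorentzian K d (contract_form v d s l f).
Proof.
move=> KA [hf f_pos f_hess]; have Kmap us : (forall u, u \in us -> K u) ->
    forall u, u \in [seq u *m contr_mx v s l | u <- us] -> K u.
  by move=> Kus _ /mapP[u /Kus/KA ? ->].
split=> [|us us_d Kus|vs vs_d Kvs]; first exact: homog_contract.
  by rewrite polar_contract // f_pos ?size_map //; exact: Kmap.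
have := f_hess _ _ (Kmap _ Kvs); rewrite size_map => /(_ vs_d)[l' h].
exists (contr_mx v s l *m l') => x; rewrite /linform mulmxA => /h.
by rewrite !qform_hessian (polar_contract _ d).
Qed.

(** The Hessians are multiples of the square of [l]. These forms show that [PL] is not empty. *)
Lemma lorentzian_linpolyX d l : (forall u, K u -> 0 < linform l u) ->
  lorentzian K d (linpoly l ^+ d).
Proof.
move=> l0.
split=> [|us us_d Kus|vs vs_d Kvs]; first exact: homog_linpolyX.
  by rewrite polar_linpolyX // mulr_gt0 ?ltr0n ?fact_gt0 // big_seq prodr_gt0 // => u /Kus/l0.
exists l => x x0; rewrite qform_hessian polar_linpolyX //= !big_cons x0.
by rewrite mul0r mulr0.
Qed.

End OperatorsLorentzian.

(** * Separation of a point from a closed cone *)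

Section ConeDuality.
Context {R : realType} {n : nat} (K : set 'rV[R]_n) (v : 'rV[R]_n).
Hypotheses (K_open : open K) (K_convex : convex_set K) (K_cone : is_cone K).
Hypothesis (Kv : K v).
Implicit Types (u w x y p : 'rV[R]_n) (l : 'cV[R]_n).

Lemma closure_coneP w : closure K w <-> forall e, 0 < e -> K (w + e *: v).
Proof.
split=> [Kw e e0|h U].
  by rewrite addrC; apply: coneD_closure => //; exact: K_cone.
have : (fun e : R => w + e *: v) @ 0^'+ --> w.
  apply: cvg_at_right_filter; rewrite -[X in _ --> X]addr0 -(scale0r v).
  apply: cvgD; first exact: cvg_cst.
  by apply: cvgZr_tmp => //; exact: cvg_id.
move=> /(_ U) /[apply] Un.
have /filter_ex[e [/= e0 Ue]] : \forall e \near (0 : R)^'+, 0 < e /\ U (w + e *: v).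
  near=> e; split; first by near: e; exact: nbhs_right_gt.
  by near: e.
by exists (w + e *: v); split => //; exact: h.
Unshelve. all: by end_near. Qed.

Lemma closure_coneZ c w : 0 < c -> closure K w -> closure K (c *: w).
Proof.
move=> c0 /closure_coneP Kw; apply/closure_coneP => e e0.
have -> : c *: w + e *: v = c *: (w + (e / c) *: v).
  by rewrite scalerDr scalerA mulrC divfK // gt_eqF.
by apply: K_cone => //; apply: Kw; exact: divr_gt0.
Qed.

Lemma nearest_point x : exists2 p, closure K p &
  forall y, closure K y -> dot (x - p) (x - p) <= dot (x - y) (x - y).
Proof.
pose q y := dot (x - y) (x - y).
have q_cont : continuous q.
  move=> y; rewrite /continuous_at /q.
  under eq_fun do rewrite dotE; rewrite dotE.
  apply: (@cvg_sum R _ (nbhs y)) => i _.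
  have xi : (x - z) 0 i @[z --> y] --> (x - y) 0 i.
    under eq_fun do rewrite 2!mxE; rewrite 2!mxE.
    apply: (@cvgB _ _ _ (nbhs y) _ (fun=> x 0 i) (fun z : 'rV[R]_n => z 0 i)).
      exact: (@cvg_cst _ _ _ (nbhs y)).
    exact: cvg_coord.
  exact: cvgM.
(* Only points at least as close to [x] as [v] compete, and they form a compact set. *)
pose S := closure K `&` [set y | q y <= q v].
have Sv : S v by split; [exact: subset_closure|rewrite /= lexx].
have Scpt : compact S.
  apply: bounded_closed_compact.
    exists (`|x| + (1 + q v)); split=> [|N xN y [_ /= yv]]; first exact: num_real.
    apply: le_trans (ltW xN); rewrite -[y](subKr x) (le_trans (ler_normB _ _)) //.
    by rewrite lerD2l (le_trans (norm_le_dot _)) // lerD2l.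
  apply: closedI; first exact: closed_closure.
  apply: (@preimage_closed _ _ q [set r | r <= q v]); last exact: closed_le.
  by move=> y _; exact: q_cont.
have [||p] := @EVT_min_rV R n q S _ Scpt.
- by exists v.
- exact: continuous_subspaceT.
rewrite inE => -[Kp pv] pmin; exists p => // y Ky.
have [yv|yv] := leP (q y) (q v); first by apply: pmin; rewrite inE.
exact: le_trans pv (ltW yv).
Qed.

(** Take the dot product with [p - x], where [p] is the nearest point. Moving [p] along [u] gives
    nonnegativity on [K]; shrinking [p] gives [dot (p - x) p <= 0], so the value at [x] is
    negative. *)
Lemma cone_separation x : ~ closure K x ->
  exists2 l, forall u, K u -> 0 <= linform l u & linform l x < 0.
Proof.
move=> Kx; have [p Kp pmin] := nearest_point x.
pose l := (p - x)^T.
have lE u : linform l u = dot (p - x) u by rewrite dotC.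
exists l; rewrite ?lE.
  move=> u Ku; rewrite lE; set c := dot (p - x) u.
  have H t : 0 < t -> 0 <= 2 * c + t * dot u u.
    move=> t0; have Kpt : closure K (t *: u + p).
      apply: subset_closure; apply: coneD_closure => //; exact: K_cone.
    have := pmin _ Kpt.
    rewrite !dot_lin (dotC p x) (dotC u x) (dotC u p) => h.
    by rewrite -(pmulr_lge0 _ t0) /c !dot_lin; lra.
  rewrite leNgt; apply/negP => c0.
  have : 0 < - c / (1 + dot u u) by rewrite divr_gt0 ?oppr_gt0 // ltr_pwDl ?dot_ge0.
  move=> /H; have u0 : 0 < 1 + dot u u by rewrite ltr_pwDl ?dot_ge0.
  have -> : - c / (1 + dot u u) * dot u u = - c + c / (1 + dot u u) by field; rewrite gt_eqF.
  have : c / (1 + dot u u) < 0 by rewrite pmulr_llt0 ?invr_gt0.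
  by move=> h1 h2; suff : (0 : R) < 0; [rewrite ltxx|lra].
have px : 0 < dot (p - x) (p - x).
  by apply: dot_gt0; apply: contra_not_neq Kx => /eqP; rewrite subr_eq0 => /eqP <-.
have pp : dot (p - x) p <= 0.
  rewrite leNgt; apply/negP => c0; set c := dot (p - x) p in c0.
  (* This [t] is less than 1 and satisfies [t * dot p p <= c], while minimality of [p] yields
     [2 * c <= t * dot p p]. *)
  pose t := c / (1 + c + dot p p).
  have D0 : 0 < 1 + c + dot p p by have := dot_ge0 p; lra.
  have t0 : 0 < t by rewrite divr_gt0.
  have t1 : t < 1 by rewrite ltr_pdivrMr // mul1r; have := dot_ge0 p; lra.
  have t1' : 0 < 1 - t by rewrite subr_gt0.
  have := pmin _ (closure_coneZ _ _ t1' Kp).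
  rewrite !dot_lin (dotC p x) => h.
  have cE : c = dot p p - dot x p by rewrite /c !dot_lin.
  have : 0 <= t * (t * dot p p - 2 * c) by rewrite cE; lra.
  rewrite pmulr_rge0 // subr_ge0 => h2.
  have : t * dot p p <= c.
    rewrite /t mulrAC ler_pdivrMr //; apply: ler_wpM2l; first exact: ltW.
    by lra.
  by move=> h3; suff : (0 : R) < 0; [rewrite ltxx|lra].
by move: px pp; rewrite !dot_lin (dotC p x); lra.
Qed.

End ConeDuality.

(** * Normalised dual forms and the lineality space *)

Section DualBasis.
Context {R : realType} {n : nat} (K : set 'rV[R]_n) (v : 'rV[R]_n).
Hypotheses (K_open : open K) (K_convex : convex_set K) (K_cone : is_cone K).
Hypothesis (Kv : K v).
Implicit Types (u w x y p : 'rV[R]_n) (l : 'cV[R]_n).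

Definition dual_normalized l := (forall u, K u -> 0 <= linform l u) /\ linform l v = 1.

(** A point outside the closed cone is separated from it by a form [l]. Some [v + e y] lies in [K]
    and [l] is negative at [y], so [l] is positive at [v] and can be normalised. *)
Lemma dual_kernel_lineality x :
  (forall l, dual_normalized l -> linform l x = 0) -> lineality K x.
Proof.
have main y : (forall l, dual_normalized l -> linform l y = 0) -> closure K y.
  move=> y0; apply: contrapT => /(cone_separation K v K_open K_convex K_cone Kv)[l l0 ly].
  have lv : 0 < linform l v.
    have [e e0 /l0] := cone_perturb K K_open v y Kv.
    by rewrite linformD linformZ => h; have := nmulr_llt0 e ly; rewrite e0 => /esym; lra.
  have lE u : linform ((linform l v)^-1 *: l) u = (linform l v)^-1 * linform l u.
    by rewrite /linform -scalemxAr mxE.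
  have := y0 ((linform l v)^-1 *: l) _; rewrite lE => /(_ _)/wrap[].
    split=> [u Ku|]; rewrite lE ?mulVf ?gt_eqF //.
    by rewrite mulr_ge0 ?l0 // invr_ge0 ltW.
  by move/eqP; rewrite mulf_eq0 invr_eq0 (gt_eqF lv) (lt_eqF ly).
move=> x0; split; apply: main => // l /x0; rewrite linformN => ->.
exact: oppr0.
Qed.

Lemma dual_closure_ge0 l y : dual_normalized l -> closure K y -> 0 <= linform l y.
Proof.
move=> [l0 lv] /(closure_coneP K v K_open K_convex K_cone Kv) Ky.
rewrite leNgt; apply/negP => ly.
have e0 : 0 < - linform l y / 2 by rewrite divr_gt0 ?oppr_gt0.
have := l0 _ (Ky _ e0); rewrite linformD linformZ lv => h.
by suff : (0 : R) < 0; [rewrite ltxx|lra].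
Qed.

(** Some [u - e v] is still in [K], so [l] is at least [e] at [u]. *)
Lemma dual_gt0 l u : dual_normalized l -> K u -> 0 < linform l u.
Proof.
move=> [l0 lv] Ku; have [e e0 /l0] := cone_perturb K K_open u (- v) Ku.
rewrite linformD linformZ linformN lv; lra.
Qed.

Lemma lineality_dual_kernel x l :
  dual_normalized l -> lineality K x -> linform l x = 0.
Proof.
move=> Dl [Kx KNx]; apply/eqP; rewrite eq_le dual_closure_ge0 //.
by rewrite andbT -oppr_ge0 -linformN dual_closure_ge0.
Qed.

Lemma linform_col m (M : 'M[R]_(n, m)) x j : linform (col j M) x = (x *m M) 0 j.
Proof. by rewrite /linform !mxE; apply: eq_bigr => i _; rewrite mxE. Qed.

(** Take normalised dual columns of maximal rank: any other normalised dual form lies in their span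
    and vanishes wherever they all do. *)
Lemma exists_dual_matrix : exists m (M : 'M[R]_(n, m)),
  (forall j, dual_normalized (col j M)) /\
  (forall x, lineality K x <-> x *m M = 0).
Proof.
pose P k := `[< exists m (M : 'M[R]_(n, m)),
   (forall j, dual_normalized (col j M)) /\ \rank M = k >].
have P0 : exists k, P k.
  exists (\rank (0 : 'M[R]_(n, 0))); apply/asboolP.
  by exists 0%N, 0; split => // -[].
have Pn k : P k -> (k <= n)%N.
  by move=> /asboolP[m [M [_ <-]]]; exact: rank_leq_row.
case: (ex_maxnP P0 Pn) => k /asboolP[m [M [DM rM]]] kmax.
exists m, M; split => // x; split => [Lx|xM0].
  apply/rowP => j; rewrite -linform_col [RHS]mxE.
  exact: lineality_dual_kernel (DM j) Lx.
apply: dual_kernel_lineality => l Dl.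
have Dl' : forall j, dual_normalized (col j (row_mx M l)).
  move=> j; case: (split_ordP j) => i ->.
    by rewrite colKl.
  by rewrite colKr [i]ord1 (_ : col 0 l = l) //; apply/colP => a; rewrite mxE.
have /kmax rle : P (\rank (row_mx M l)).
  by apply/asboolP; exists (m + 1)%N, (row_mx M l).
have sub : (M^T <= col_mx M^T l^T)%MS by rewrite -addsmxE addsmxSl.
have : (col_mx M^T l^T <= M^T)%MS.
  rewrite -(geq_leqif (mxrank_leqif_sup sub)) -tr_row_mx !mxrank_tr rM.
  exact: rle.
rewrite col_mx_sub => /andP[_ /submxP[z lz]].
rewrite /linform -[l]trmxK lz trmx_mul trmxK mulmxA xM0 mul0mx mxE //.
Qed.

Lemma mulmx_continuous m (B : 'M[R]_(n, m)) : continuous (fun x : 'rV[R]_n => x *m B).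
Proof.
move=> x; apply: (@cvg_mx_coord R _ (nbhs x)) => i j.
under eq_fun do rewrite mxE; rewrite mxE.
apply: (@cvg_sum R _ (nbhs x)) => k _.
by apply: cvgMl; exact: cvg_coord.
Qed.

(** Otherwise [0 = v + (- v)] would be in [K], and an open cone containing 0 is the whole space. *)
Lemma not_lineality_v : K <> setT -> ~ lineality K (- v).
Proof.
move=> KT [KNv _]; apply: KT; have K0 : K 0.
  by rewrite -(subrr v); exact: coneD_closure.
apply/seteqP; split => // w _; have [e e0] := cone_perturb K K_open 0 w K0.
rewrite add0r => Kew; rewrite -[w]scale1r -(@mulVf _ e) ?gt_eqF // -scalerA.
by apply: K_cone; rewrite ?invr_gt0.
Qed.

End DualBasis.

(** * Coefficientwise convergence of polynomials *)

Section CoefficientwiseConvergence.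
Context {R : realType} {n : nat} {T : Type} (F : set_system T) {FF : Filter F}.
Implicit Types (f : mpoly n R) (g : T -> mpoly n R).

Definition mcvg g f : Prop := forall m, mcoeff m (g x) @[x --> F] --> mcoeff m f.

Lemma mcvgD g1 g2 f1 f2 : mcvg g1 f1 -> mcvg g2 f2 ->
  mcvg (fun x => g1 x + g2 x) (f1 + f2).
Proof.
move=> h1 h2 m; under eq_fun do rewrite mcoeffD; rewrite mcoeffD.
exact: cvgD (h1 m) (h2 m).
Qed.

Lemma mcvgZ (a : T -> R) (a0 : R) g f : a @ F --> a0 -> mcvg g f ->
  mcvg (fun x => a x *: g x) (a0 *: f).
Proof.
move=> h1 h2 m; under eq_fun do rewrite mcoeffZ; rewrite mcoeffZ.
exact: cvgM h1 (h2 m).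
Qed.

Lemma mcvg_sum (I : Type) (r : seq I) (P : pred I) (g : I -> T -> mpoly n R)
    (f : I -> mpoly n R) :
  (forall i, P i -> mcvg (g i) (f i)) ->
  mcvg (fun x => \sum_(i <- r | P i) g i x) (\sum_(i <- r | P i) f i).
Proof.
move=> h m; under eq_fun do rewrite raddf_sum; rewrite raddf_sum /=.
by apply: cvg_sum => i Pi; exact: h.
Qed.

Lemma mcvgMl p g f : mcvg g f -> mcvg (fun x => p * g x) (p * f).
Proof.
move=> h m; under eq_fun do rewrite mcoeffM; rewrite mcoeffM.
by apply: cvg_sum => k _; apply: cvgMr; exact: h.
Qed.

Lemma mcvg_mderiv i g f : mcvg g f -> mcvg (fun x => mderiv i (g x)) (mderiv i f).
Proof.
move=> h m.
have E p : mcoeff m (mderiv i p) = mcoeff (mnm_add m (mnm1 i)) p * (m i).+1%:R.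
  by rewrite mcoeff_deriv mulr_natr.
by under eq_fun do rewrite E; rewrite E; apply: cvgMl; exact: h.
Qed.

Lemma mcvg_dirD (u : T -> 'rV[R]_n) (u0 : 'rV[R]_n) g f :
  (forall i, u x 0 i @[x --> F] --> u0 0 i) -> mcvg g f ->
  mcvg (fun x => dirD (u x) (g x)) (dirD u0 f).
Proof.
by move=> hu hg; apply: mcvg_sum => i _; apply: mcvgZ => //; exact: mcvg_mderiv.
Qed.

Lemma mcvg_dirDs (I : Type) (r : seq I) (u : I -> T -> 'rV[R]_n)
    (u0 : I -> 'rV[R]_n) g f :
  (forall i j, u i x 0 j @[x --> F] --> u0 i 0 j) -> mcvg g f ->
  mcvg (fun x => dirDs [seq u i x | i <- r] (g x)) (dirDs [seq u0 i | i <- r] f).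
Proof. by move=> hu hg; elim: r => //= i r IH; exact: mcvg_dirD. Qed.

End CoefficientwiseConvergence.

(** * The topology on forms and uniform positivity over compact sets *)

Section FormTopology.
Context {R : realType} {n d : nat}.
Implicit Types (f g : dhomog n R d).

(** Coefficients of degree [d] are coordinates of [form_coefs]; the others are identically zero. *)
Lemma mcvg_id f : mcvg (nbhs f) (fun g : dhomog n R d => g : mpoly n R) f.
Proof.
move=> m.
have [md|md] := eqVneq (mdeg m) d; last first.
  under eq_fun do rewrite (homog_coef _ _ _ (dhomog_is_dhomog _) md).
  rewrite (homog_coef _ _ _ (dhomog_is_dhomog _) md); exact: (@cvg_cst _ _ _ (nbhs f)).
have md1 : (mdeg m < d.+1)%N by rewrite md.
have E g : mcoeff m g = form_coefs g 0 (enum_rank (BMultinom md1)).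
  by rewrite mxE enum_rankK.
under eq_fun do rewrite E; rewrite E.
apply: (@cvg_comp _ _ _ form_coefs (fun A : 'rV[R]__ => A 0 _) _ (nbhs (form_coefs f))).
  exact: (@initial_continuous _ _ (@form_coefs R n d)).
exact: cvg_coord.
Qed.

Lemma cvg_form (T : Type) (F : set_system T) (g : T -> dhomog n R d) f : Filter F ->
  mcvg F (fun x => g x : mpoly n R) f -> g @ F --> f.
Proof.
move=> FF gf U [V /= [[W oW <-]] /= Wf /filterS]; apply.
have : form_coefs (g x) @[x --> F] --> form_coefs f.
  apply: cvg_mx_coord => i j; under eq_fun do rewrite mxE; rewrite mxE.
  exact: gf.
by apply; exact: open_nbhs_nbhs.
Qed.

(** Tube lemma: positivity persists near each [(x, i0)], and compactness of [E] makes the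
    neighbourhood of [i0] uniform. *)
Lemma near_compact_gt0 (X I : topologicalType) (E : set X) (i0 : I)
    (phi : X -> I -> R) : compact E ->
  (forall x, E x -> phi z.1 z.2 @[z --> (x, i0)] --> phi x i0) ->
  (forall x, E x -> 0 < phi x i0) ->
  \forall i \near i0, forall x, E x -> 0 < phi x i.
Proof.
move=> /compact_near_coveringP cE phi_cvg phi0.
have := cE I (nbhs i0) (fun i x => 0 < phi x i) _; apply => x Ex.
exact: cvgr_gt (phi_cvg x Ex) _ (phi0 x Ex).
Qed.

End FormTopology.

(** * A compact base of the closed cone modulo its lineality space *)

Section CompactBase.
Context {R : realType} {n : nat} (K : set 'rV[R]_n) (v : 'rV[R]_n).
Hypotheses (K_open : open K) (K_convex : convex_set K) (K_cone : is_cone K).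
Hypothesis (Kv : K v).
Implicit Types (u w x y p : 'rV[R]_n) (l : 'cV[R]_n).
Context {m : nat} (M : 'M[R]_(n, m)).
Hypothesis dualM : forall j, dual_normalized K v (col j M).
Hypothesis linealityM : forall x, lineality K x <-> x *m M = 0.
Hypothesis m_gt0 : (0 < m)%N.

Definition dual_mean : 'cV[R]_n := M *m const_mx m%:R^-1.

Local Notation l0 := dual_mean.

Lemma dual_meanE x : linform l0 x = m%:R^-1 * \sum_j (x *m M) 0 j.
Proof.
rewrite /linform /dual_mean mulmxA mxE mulr_sumr; apply: eq_bigr => j _.
by rewrite !mxE mulrC.
Qed.

Let m_neq0 : m%:R != 0 :> R. Proof. by rewrite pnatr_eq0 -lt0n. Qed.

Lemma dual_mean_normalized : dual_normalized K v l0.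
Proof.
split=> [u Ku|]; rewrite dual_meanE.
  rewrite mulr_ge0 ?invr_ge0 // sumr_ge0 // => j _.
  by rewrite -linform_col; case: (dualM j) => + _; apply.
rewrite (eq_bigr (fun=> 1)) => [|j _]; last by rewrite -linform_col; case: (dualM j).
by rewrite sumr_const card_ord mulVf.
Qed.

Lemma dual_mean_v : linform l0 v = 1.
Proof. by case: dual_mean_normalized. Qed.

Lemma dual_mean_gt0 u : K u -> 0 < linform l0 u.
Proof. exact: (dual_gt0 K v K_open) dual_mean_normalized. Qed.

Lemma dual_mean_lineality w : lineality K w -> linform l0 w = 0.
Proof.
exact: (lineality_dual_kernel K v K_open K_convex K_cone Kv) dual_mean_normalized.
Qed.

(** An idempotent whose kernel is the lineality space: the projection along it onto a complement. *)
Definition transversal_mx : 'M[R]_n := M *m pinvmx M.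

Local Notation pr := transversal_mx.

Lemma transversalM x : x *m pr *m M = x *m M.
Proof. by rewrite /transversal_mx -mulmxA mulmxKpV. Qed.

Lemma lineality_transversal w : lineality K w -> w *m pr = 0.
Proof. by move=> /linealityM wM; rewrite /transversal_mx mulmxA wM mul0mx. Qed.

Lemma lineality_transversalB x : lineality K (x - x *m pr).
Proof. by apply/linealityM; rewrite mulmxBl transversalM subrr. Qed.

Lemma transversal_idem x : x *m pr *m pr = x *m pr.
Proof. by rewrite {2}/transversal_mx mulmxA transversalM -mulmxA. Qed.

Lemma dual_mean_transversal x : linform l0 (x *m pr) = linform l0 x.
Proof. by rewrite !dual_meanE transversalM. Qed.

(** The slice is confined to the complement, since it would otherwise be unbounded along a nonzero
    lineality space. *)
Definition cone_base : set 'rV[R]_n :=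
  [set y | [/\ y *m pr = y, closure K y & linform l0 y = 1]].

Lemma closed_linform_eq l (c : R) : closed [set y : 'rV[R]_n | linform l y = c].
Proof.
apply: (@preimage_closed _ _ (linform l) [set c]); last exact: closed_eq.
move=> y _; rewrite /continuous_at /linform; under eq_fun do rewrite mxE; rewrite mxE.
by apply: (@cvg_sum R _ (nbhs y)) => k _; apply: cvgMl; exact: cvg_coord.
Qed.

(** On the base the entries of [y *m M] are nonnegative with sum [m], so they lie in a box, and
    [pinvmx M] recovers [y] from them. *)
Lemma compact_cone_base : compact cone_base.
Proof.
pose box : set 'rV[R]_m := [set z | forall i, `[0, m%:R]%classic (z ord0 i)].
have cbox : compact box.
  by apply: (@rV_compact R m (fun=> `[0, m%:R]%classic)) => i; exact: segment_compact.
have cimg : compact [set z *m pinvmx M | z in box].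
  by apply: continuous_compact => //; apply: continuous_subspaceT; exact: mulmx_continuous.
apply: subclosed_compact cimg _.
  rewrite (_ : cone_base = (\bigcap_(j in [set: 'I_n])
     [set y | linform (col j (pr - 1%:M)) y = 0]) `&`
     (closure K `&` [set y | linform l0 y = 1])).
    apply: closedI; first by apply: closed_bigI => j _; exact: closed_linform_eq.
    by apply: closedI; [exact: closed_closure|exact: closed_linform_eq].
  apply/seteqP; split => [y [yp Ky y1]|y [yp [Ky y1]]]; split => //.
    by move=> j _ /=; rewrite linform_col mulmxBr mulmx1 yp subrr mxE.
  apply/eqP; rewrite -subr_eq0; apply/eqP/rowP => j.
  by have := yp j I; rewrite /= linform_col mulmxBr mulmx1 => ->; rewrite mxE.
move=> y [yp Ky y1]; exists (y *m M); last by rewrite -mulmxA.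
have yM j : 0 <= (y *m M) 0 j.
  by rewrite -linform_col; apply: (dual_closure_ge0 K v K_open) (dualM j) Ky.
move=> j /=; rewrite in_itv /= yM /=.
have : \sum_j (y *m M) 0 j = m%:R.
  by apply: (mulfI (invr_neq0 m_neq0)); rewrite -dual_meanE y1 mulVf.
by move=> <-; rewrite (bigD1 j) //= lerDl sumr_ge0.
Qed.

Definition to_base u := (linform l0 u)^-1 *: (u *m pr).

Lemma to_baseP u : K u -> cone_base (to_base u).
Proof.
move=> Ku; have u0 := dual_mean_gt0 _ Ku.
split; first by rewrite -scalemxAl transversal_idem.
  apply: (closure_coneZ K v) => //; first by rewrite invr_gt0.
  apply: subset_closure; rewrite -[u *m pr](subrKC u); apply: coneD_closure => //.
  by have [_] := lineality_transversalB u; rewrite opprB.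
by rewrite linformZ dual_mean_transversal mulVf // gt_eqF.
Qed.

Lemma to_base_dirD u (g : mpoly n R) : K u ->
  (forall w, lineality K w -> dirD w g = 0) ->
  dirD u g = linform l0 u *: dirD (to_base u) g.
Proof.
move=> Ku g0; have u0 := dual_mean_gt0 _ Ku.
rewrite -dirDZl /to_base scalerA divff ?gt_eqF // scale1r.
rewrite -{1}(subrK (u *m pr) u) -[u - _]scale1r dirD_comb g0 ?scaler0 ?add0r //.
exact: lineality_transversalB.
Qed.

(** Each [u] in [K] is a positive multiple of a base point up to the lineality space, along which
    [g] is constant. *)
Lemma polar_to_base us (g : mpoly n R) : (forall u, u \in us -> K u) ->
  (forall w, lineality K w -> dirD w g = 0) ->
  polar us g = (\prod_(u <- us) linform l0 u) * polar [seq to_base u | u <- us] g.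
Proof.
elim: us g => [|u us IH] g Kus g0; first by rewrite big_nil mul1r.
rewrite /= !polar_cons (to_base_dirD u) //; last by apply: Kus; rewrite mem_head.
rewrite polarZ IH; first by rewrite big_cons mulrA.
  by move=> w wus; apply: Kus; rewrite inE wus orbT.
by move=> w Lw; rewrite dirDC g0 // linear0.
Qed.

Lemma contr_mx_v s : v *m contr_mx v s l0 = v.
Proof. by rewrite mul_contr_mx dual_mean_v mulr1 -scalerDl subrK scale1r. Qed.

Lemma contr_mx_cone s u : 0 <= s <= 1 -> K u -> K (u *m contr_mx v s l0).
Proof.
move=> /andP[s0 s1] Ku; rewrite mul_contr_mx; have u0 := dual_mean_gt0 _ Ku.
have [->|sn0] := eqVneq s 0; first by rewrite subr0 scale1r mul0r scale0r addr0.
have sp : 0 < s by rewrite lt_neqAle eq_sym sn0.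
have Ksv : K ((s * linform l0 u) *: v) by apply: K_cone => //; exact: mulr_gt0.
have [->|sn1] := eqVneq s 1.
  by rewrite subrr scale0r add0r mul1r; exact: K_cone.
apply: coneD => //; apply: K_cone => //.
by rewrite subr_gt0 lt_neqAle sn1.
Qed.

Lemma contr_mx_base s y : 0 < s < 1 -> cone_base y -> K (y *m contr_mx v s l0).
Proof.
move=> /andP[s0 s1] [_ Ky y1]; rewrite mul_contr_mx y1 mulr1 addrC.
apply: coneD_closure => //; first exact: K_cone.
by apply: (closure_coneZ K v) => //; rewrite subr_gt0.
Qed.

(** Both linear conditions are packed into one block matrix, to fit [compact_unit_sphere]. *)
Definition unit_transversal : set 'rV[R]_n :=
  [set x | x *m row_mx l0 (pr - 1%:M) = 0 /\ dot x x = 1].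

Lemma unit_transversalE x : unit_transversal x ->
  [/\ linform l0 x = 0, x *m pr = x & dot x x = 1].
Proof.
move=> []; rewrite mul_mx_row -row_mx0 => /eq_row_mx[x0 xp] x1; split => //.
  by rewrite /linform x0 mxE.
by apply/eqP; rewrite -subr_eq0 -{2}[x]mulmx1 -mulmxBr xp.
Qed.

Lemma unit_transversal_intro x : linform l0 x = 0 -> x *m pr = x -> dot x x = 1 ->
  unit_transversal x.
Proof.
move=> x0 xp x1; split => //; rewrite mul_mx_row mulmxBr mulmx1 xp subrr.
by rewrite (_ : x *m l0 = 0) ?row_mx0 //; apply/matrixP => i j; rewrite !ord1 [RHS]mxE.
Qed.

End CompactBase.

(** * Interior points among the forms constant along the lineality space *)

Section Interior.
Context {R : realType} {n : nat} (K : set 'rV[R]_n) (v : 'rV[R]_n).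
Hypotheses (K_open : open K) (K_convex : convex_set K) (K_cone : is_cone K).
Hypothesis (Kv : K v).
Implicit Types (u w x y p : 'rV[R]_n) (l : 'cV[R]_n).
Context {m : nat} (M : 'M[R]_(n, m)).
Hypothesis dualM : forall j, dual_normalized K v (col j M).
Hypothesis linealityM : forall x, lineality K x <-> x *m M = 0.
Hypothesis m_gt0 : (0 < m)%N.

Local Notation l0 := (dual_mean M).
Local Notation pr := (transversal_mx M).
Local Notation base := (cone_base K M).
Local Notation to_base := (to_base M).

(** Tuples of directions are kept as rows of vectors, to which [rV_compact] applies; this turns them
    into arguments of [polar]. *)
Definition row_vectors k (V : 'rV['rV[R]_n]_k) : seq 'rV[R]_n :=
  [seq V ord0 i | i <- enum 'I_k].

Lemma size_row_vectors k (V : 'rV_k) : size (row_vectors k V) = k.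
Proof. by rewrite size_map size_enum_ord. Qed.

Definition base_rows k : set 'rV['rV[R]_n]_k := [set V | forall i, base (V ord0 i)].

Lemma compact_base_rows k : compact (base_rows k).
Proof.
apply: (@rV_compact 'rV[R]_n k (fun=> base)) => _.
exact: (compact_cone_base K v).
Qed.

Lemma row_vectors_base k us : size us = k -> (forall u, u \in us -> K u) ->
  exists2 V : 'rV_k, base_rows k V & row_vectors k V = [seq to_base u | u <- us].
Proof.
move=> us_k Kus; exists (\row_i to_base (nth 0 us i)).
  by move=> i; rewrite mxE; apply: (to_baseP K v) => //; apply/Kus/mem_nth; rewrite us_k.
apply: (@eq_from_nth _ 0); first by rewrite size_row_vectors size_map us_k.
move=> i; rewrite size_row_vectors => ik.
rewrite /row_vectors (nth_map (Ordinal ik)) ?size_enum_ord // mxE nth_enum_ord //.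
by rewrite (nth_map 0) ?us_k.
Qed.

Lemma cvg_rows k (V : 'rV['rV[R]_n]_k) i j :
  (W ord0 i : 'rV[R]_n) 0 j @[W --> V] --> (V ord0 i : 'rV[R]_n) 0 j.
Proof.
apply: (@cvg_comp _ _ _ (fun W : 'rV['rV[R]_n]_k => W ord0 i)
  (fun x : 'rV[R]_n => x 0 j) (nbhs V) (nbhs (V ord0 i))); last exact: cvg_coord.
(* A product neighbourhood that constrains the entry [i] only. *)
by move=> U VU; exists (fun a b => if b == i then U else setT);
  [move=> a b; rewrite [a]ord1; case: eqP => [->//|_]; exact: filterT
  |move=> W /(_ ord0 i); rewrite eqxx].
Qed.

Variable (d : nat).
Hypothesis (d_gt0 : (0 < d)%N).

Section Near.
Variables (h : mpoly n R) (g : dhomog n R d) (s : R).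
Hypotheses (h_lor : lorentzian K d h) (s01 : 0 < s < 1).
Hypothesis (gE : contract_form v d s l0 h = g :> mpoly n R).
Hypothesis (h_ker : (1 < d)%N -> forall x, dirD x h = 0 -> lineality K x).

Let h_homog : homog d h. Proof. by case: h_lor. Qed.

Let polar_g us : size us = d -> polar us g = polar [seq u *m contr_mx v s l0 | u <- us] h.
Proof. by move=> us_d; rewrite -gE polar_contract. Qed.

Let K_rows k (V : 'rV_k) : base_rows k V ->
  forall u, u \in [seq w *m contr_mx v s l0 | w <- row_vectors k V] -> K u.
Proof.
by move=> bV u /mapP[w /mapP[i _ ->] ->]; apply: (contr_mx_base K v).
Qed.

(** The contraction takes base points into the open cone, where [h] is positive. Compactness extends
    this to nearby forms, and [polar_to_base] extends it from the base to [K]. *)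
Lemma near_polar_pos : {near g, forall (g' : dhomog n R d),
  forall us : seq 'rV[R]_n, size us = d ->
  (forall u, u \in us -> K u) -> (forall w, lineality K w -> dirD w g' = 0) ->
  0 < polar us g'}.
Proof.
have : {near g, forall (g' : dhomog n R d), forall V : 'rV_d, base_rows d V ->
    0 < polar (row_vectors d V) g'}.
  apply: (near_compact_gt0 _ _ (base_rows d) g
    (fun V g' => polar (row_vectors d V) (g' : dhomog n R d))).
  - exact: compact_base_rows.
  - move=> V bV; apply: (mcvg_dirDs (nbhs (V, g)) _ (enum 'I_d)
      (fun i z => z.1 ord0 i) (fun i => V ord0 i) (fun z => z.2)).
      move=> i j; apply: (@cvg_comp _ _ _ fst
        (fun W : 'rV['rV[R]_n]_d => W ord0 i 0 j) (nbhs (V, g)) (nbhs V)).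
        exact: cvg_fst.
      exact: cvg_rows.
    move=> k; apply: (@cvg_comp _ _ _ snd (fun g' : dhomog n R d => mcoeff k g')
      (nbhs (V, g)) (nbhs g)); [exact: cvg_snd|exact: mcvg_id].
  move=> V bV; rewrite polar_g ?size_row_vectors //.
  case: h_lor => _ + _; apply; first by rewrite size_map size_row_vectors.
  exact: K_rows.
apply: filterS => g' g'_pos us us_d Kus g'0.
rewrite (polar_to_base K v K_open M dualM linealityM m_gt0) // mulr_gt0 //.
  by rewrite big_seq prodr_gt0 // => u /Kus; exact: (dual_mean_gt0 K v).
by have [V bV <-] := row_vectors_base _ _ us_d Kus; exact: g'_pos.
Qed.

(** Strictness of the reversed Cauchy-Schwarz inequality is an open condition. At [g], equality
    would make the component [y] of [x'] orthogonal to [v] isotropic, so [y] would lie in the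
    lineality space; then [linform l0 y = 0] and [y *m pr = 0] force [x = 0]. *)
Lemma near_discriminant : (1 < d)%N -> {near g, forall (g' : dhomog n R d),
  forall xV : 'rV[R]_n * 'rV['rV[R]_n]_d.-2,
  (unit_transversal M `*` base_rows d.-2) xV ->
  let vs := row_vectors d.-2 xV.2 in let x := xV.1 in
  0 < polar [:: x, v & vs] g' ^+ 2 - polar [:: x, x & vs] g' * polar [:: v, v & vs] g'}.
Proof.
move=> d2; have d2E : d.-2.+2 = d by case: d d2 => [|[]].
apply: (near_compact_gt0 _ _ (unit_transversal M `*` base_rows d.-2) g
  (fun xV g' => polar [:: xV.1, v & row_vectors d.-2 xV.2] (g' : dhomog n R d) ^+ 2 -
    polar [:: xV.1, xV.1 & row_vectors d.-2 xV.2] g' *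
    polar [:: v, v & row_vectors d.-2 xV.2] g')).
- by apply: compact_setX; [exact: compact_unit_sphere|exact: compact_base_rows].
- move=> [x V] [_ bV] /=.
  have rows_cvg : mcvg (nbhs ((x, V), g))
      (fun z : ('rV[R]_n * 'rV['rV[R]_n]_d.-2) * dhomog n R d =>
       dirDs (row_vectors d.-2 z.1.2) z.2) (dirDs (row_vectors d.-2 V) g).
    apply: (mcvg_dirDs (nbhs ((x, V), g)) _ (enum 'I_d.-2)
      (fun i z => z.1.2 ord0 i) (fun i => V ord0 i) (fun z => z.2)).
      move=> i j; apply: (@cvg_comp _ _ _
        (fun z : ('rV[R]_n * 'rV['rV[R]_n]_d.-2) * dhomog n R d => z.1.2)
        (fun W : 'rV['rV[R]_n]_d.-2 => W ord0 i 0 j) (nbhs ((x, V), g)) (nbhs V));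
        last exact: cvg_rows.
      apply: (@cvg_comp _ _ _ fst snd (nbhs ((x, V), g)) (nbhs (x, V))).
        exact: cvg_fst.
      exact: cvg_snd.
    move=> k; apply: (@cvg_comp _ _ _ snd (fun g' : dhomog n R d => mcoeff k g')
      (nbhs ((x, V), g)) (nbhs g)); [exact: cvg_snd|exact: mcvg_id].
  have x_cvg i : (z.1.1 : 'rV[R]_n) 0 i @[z --> ((x, V), g)] --> x 0 i.
    apply: (@cvg_comp _ _ _ (fun z : ('rV[R]_n * 'rV['rV[R]_n]_d.-2) * dhomog n R d => z.1.1)
        (fun y : 'rV[R]_n => y 0 i) (nbhs ((x, V), g)) (nbhs x)); last exact: cvg_coord.
    by apply: (@cvg_comp _ _ _ fst fst (nbhs ((x, V), g)) (nbhs (x, V))); exact: cvg_fst.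
  have v_cvg i : v 0 i @[z --> ((x, V), g)] --> v 0 i.
    exact: (@cvg_cst _ _ _ (nbhs ((x, V), g))).
  have polar_cvg (a b : ('rV[R]_n * 'rV['rV[R]_n]_d.-2) * dhomog n R d -> 'rV[R]_n)
      (a0 b0 : 'rV[R]_n) :
      (forall i, a z 0 i @[z --> ((x, V), g)] --> a0 0 i) ->
      (forall i, b z 0 i @[z --> ((x, V), g)] --> b0 0 i) ->
      polar [:: a z, b z & row_vectors d.-2 z.1.2] z.2 @[z --> ((x, V), g)] -->
      polar [:: a0, b0 & row_vectors d.-2 V] g.
    by move=> ha hb; apply: (mcvg_dirD _ _ _ _ _ ha (mcvg_dirD _ _ _ _ _ hb rows_cvg)).
  apply: cvgB; first by apply: cvgM; exact: polar_cvg.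
  by apply: cvgM; exact: polar_cvg.
move=> [x V] [xW bV] /=; have [x0 xp x1] := unit_transversalE M x xW.
have s1 : 0 < 1 - s by rewrite subr_gt0; case/andP: s01.
have xA : x *m contr_mx v s l0 = (1 - s) *: x.
  by rewrite mul_contr_mx x0 mulr0 scale0r addr0.
have vA : v *m contr_mx v s l0 = v by apply: (contr_mx_v K).
rewrite !polar_g /= ?size_row_vectors // xA vA.
set x' := (1 - s) *: x; set vs := [seq _ | w <- row_vectors _ _].
have Kvs : forall u, u \in vs -> K u by exact: K_rows.
have vs_d : (size vs).+2 = d by rewrite size_map size_row_vectors.
have p0 : 0 < polar [:: v, v & vs] h.
  case: h_lor => _ h_pos _; apply: h_pos; first exact: vs_d.
  by apply: inK_cons => //; apply: inK_cons.
have CS := lorentzian_CS K d h h_lor v vs x' vs_d Kv Kvs.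
rewrite subr_gt0 lt_neqAle CS andbT; apply/eqP => E.
pose r := polar [:: x', v & vs] h; pose p := polar [:: v, v & vs] h.
pose y := p *: x' + ((- r) *: v + 0).
have y0 : linform l0 y = - r.
  rewrite /y !linform_comb linformZ x0 (dual_mean_v K v) //.
  by rewrite /linform mul0mx mxE; ring.
have Ly : lineality K y.
  apply: h_ker => //; apply: (kernel_lineality K v K_open Kv d h h_lor vs) => //.
  have yP b : polar [:: y, b & vs] h =
      p * polar [:: x', b & vs] h - r * polar [:: v, b & vs] h.
    by rewrite /y !polar_comb polar0l; ring.
  have yv : polar [:: y, v & vs] h = 0 by rewrite yP -/p -/r; ring.
  clearbody y; move=> z; apply: (lorentzian_isotropic K d h h_lor v) => //.
  rewrite yP (polar_swap v y) yv (polar_swap x' y) yP (polar_swap v x') -/r.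
  rewrite mulr0 subr0 [_ * polar _ _]mulrC -[r * r]expr2 -E; apply/eqP.
  by rewrite mulf_eq0 subr_eq0 eqxx orbT.
have r0 : r = 0.
  by apply/oppr_inj; rewrite -y0 oppr0; apply: (dual_mean_lineality K v).
have : y *m pr = 0 by exact: (lineality_transversal K).
rewrite /y r0 oppr0 scale0r !addr0 /x' -!scalemxAl xp => /eqP.
rewrite !scaler_eq0 (gt_eqF p0) (gt_eqF s1) /= => /eqP x00.
by move: x1; rewrite x00 /dot mul0mx mxE => /eqP; rewrite eq_sym oner_eq0.
Qed.

Lemma contract_interior : {near g, forall (g' : dhomog n R d),
  (forall w, lineality K w -> dirD w g' = 0) -> lorentzian K d g'}.
Proof.
have [d2|d1] := ltnP 1 d; last first.
  (* In degree one there is no Hessian to control. *)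
  apply: filterS near_polar_pos => g' g'_pos g'0; split.
  - exact: dhomog_is_dhomog.
  - by move=> us us_d Kus; exact: g'_pos.
  - move=> vs vs_d; have : (1 < d)%N by rewrite -vs_d.
    by rewrite ltnNge d1.
apply: filterS2 near_polar_pos (near_discriminant d2) => g' g'_pos g'_disc g'0.
split=> [|us us_d Kus|vs vs_d Kvs]; [exact: dhomog_is_dhomog|exact: g'_pos|].
exists (hessian (dirDs vs g') *m v^T) => x.
rewrite /linform mulmxA -/(qform _ x v) !qform_hessian => xv.
pose P a b := polar [:: a, b & vs] g'.
have vs_d2 : size vs = d.-2 by rewrite -vs_d.
have [V bV VE] := row_vectors_base _ _ vs_d2 Kvs.
have PE a b : P a b = (\prod_(u <- vs) linform l0 u) *
    polar [:: a, b & row_vectors d.-2 V] g'.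
  rewrite /P !polar_cons (polar_to_base K v K_open M dualM linealityM m_gt0) -?VE // => w Lw.
  by rewrite dirDC (dirDC w) g'0 // !linear0.
have p0 : 0 < P v v by apply: g'_pos => //; apply: inK_cons => //; apply: inK_cons.
(* Splits [x] as [c v + w + z], with [w] in the lineality space and [z] in the complement and in the
   kernel of [l0]. *)
pose c := linform l0 x; pose x1 := x + (- c) *: v.
pose z := x1 *m pr; pose w := x1 - z.
have Lw : lineality K w by apply: lineality_transversalB.
have wP b : P w b = 0 by rewrite /P polar_cons g'0 // linear0.
have xE : x = c *: v + (w + z).
  by rewrite /w subrK /x1 scaleNr addrC subrK.
have Psym a b : P a b = P b a by exact: polar_swap.
have xP b : P x b = c * P v b + P z b.
  by rewrite /P {1}xE polar_comb polarDl -/(P w b) wP add0r.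
have zv : P z v = - (c * P v v) by move: xv; rewrite -/(P x v) xP; lra.
(* Adding a multiple of [v] does not change the discriminant, so this inequality passes to [x],
   where [P x v = 0]. *)
suff disc : P z z * P v v <= P z v ^+ 2.
  rewrite -/(P x x) xP (Psym v x) (Psym z x) !xP (Psym v z) zv.
  rewrite -(pmulr_lle0 _ p0); move: disc; rewrite zv expr2; nra.
have [z0|z0] := eqVneq z 0.
  by rewrite z0 /P polar0l mul0r sqr_ge0.
have zz := dot_gt0 _ z0; pose q := (Num.sqrt (dot z z))^-1.
have q0 : 0 < q by rewrite invr_gt0 sqrtr_gt0.
have qz : unit_transversal M (q *: z).
  apply: unit_transversal_intro.
  - rewrite linformZ dual_mean_transversal // /x1 linformD linformZ (dual_mean_v K v) //.
    by rewrite -/c mulr1 subrr mulr0.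
  - by rewrite -scalemxAl transversal_idem.
  - by rewrite dotZ exprVn sqr_sqrtr ?dot_ge0 // mulVf // gt_eqF.
have := g'_disc (q *: z, V) (conj qz bV) => /=.
rewrite !polarZl !polarZl2 !PE; set a := \prod_(u <- vs) _.
set P1 := polar [:: z, v & _] _; set P2 := polar [:: z, z & _] _.
set P3 := polar [:: v, v & _] _ => H.
have a0 : 0 < a by rewrite /a big_seq prodr_gt0 // => u /Kvs; exact: (dual_mean_gt0 K v).
rewrite -subr_ge0 (_ : _ - _ = a ^+ 2 * (P1 ^+ 2 - P2 * P3)); last by ring.
rewrite mulr_ge0 ?sqr_ge0 // -(pmulr_rge0 _ (exprn_gt0 2 q0)).
by move: H; rewrite (_ : _ - _ = q ^+ 2 * (P1 ^+ 2 - P2 * P3)); [exact: ltW|ring].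
Qed.

End Near.

End Interior.

(** * Limits of normalised Lorentzian forms *)

Section Closedness.
Context {R : realType} {n : nat} (K : set 'rV[R]_n) (v : 'rV[R]_n).
Hypotheses (K_open : open K).
Hypothesis (Kv : K v).
Implicit Types (u w x y p : 'rV[R]_n) (us vs : seq 'rV[R]_n).

Lemma cvg_polar d us (f : dhomog n R d) :
  polar us (g : dhomog n R d) @[g --> f] --> polar us f.
Proof.
have := mcvg_dirDs (nbhs f) _ us (fun u _ => u) id
   (fun g : dhomog n R d => g : mpoly n R) f _ (mcvg_id f) mnm0.
by rewrite map_id; apply => i j; exact: (@cvg_cst _ _ _ (nbhs f)).
Qed.

Lemma closure_ge0 (T : topologicalType) (A : set T) (phi : T -> R) (x : T) :
  closure A x -> phi @ x --> phi x -> (forall y : T, A y -> 0 <= phi y) -> 0 <= phi x.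
Proof.
move=> Ax phi_cvg phi0; rewrite leNgt; apply/negP => phix.
have /Ax[y [Ay /=]] : \forall y \near x, phi y < 0 by exact: cvgr_lt phi_cvg _ phix.
by rewrite ltNge phi0.
Qed.

(** Write [u] as [e v + (u - e v)] with both summands in [K]: the first contributes strictly, by
    induction applied to [dirD v g], and the second is nonnegative. *)
Lemma polar_gt0_of_ge0 k (g : mpoly n R) :
  (forall us, size us = k -> (forall u, u \in us -> K u) -> 0 <= polar us g) ->
  0 < polar (nseq k v) g ->
  forall us, size us = k -> (forall u, u \in us -> K u) -> 0 < polar us g.
Proof.
elim: k g => [|k IH] g g0 gv [|u us] //= [us_k] Kus.
have Ku : K u by apply: Kus; rewrite mem_head.
have Kus' : forall w, w \in us -> K w by move=> w wus; apply: Kus; rewrite inE wus orbT.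
have [e e0 Ke] := cone_perturb K K_open u (- v) Ku.
have gvus : 0 < polar (v :: us) g.
  rewrite polar_cons; apply: IH => // [ws ws_k Kws|]; last by rewrite -polar_cons.
  by rewrite -polar_cons g0 //= ?ws_k //; exact: inK_cons.
have -> : u = e *: v + (u + e *: (- v)) by rewrite scalerN addrC subrK.
rewrite polar_comb ltr_pwDl ?mulr_gt0 // g0 //= ?us_k //; exact: inK_cons.
Qed.

Lemma polar_diag_unit d (f : dhomog n R d) :
  unit_at v d f <-> polar (nseq d v) f = d`!%:R.
Proof.
have d0 : (d`!%:R : R) != 0 by rewrite pnatr_eq0 -lt0n fact_gt0.
rewrite (polar_nseq_meval _ _ _ (dhomog_is_dhomog f)); split=> [->|h]; first by rewrite mulr1.
by apply: (mulfI d0); rewrite h mulr1.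
Qed.

(** The inequality of [lorentzian_CS] passes to limits, and it implies nonpositivity on the
    hyperplane [polar [:: x, v & vs] f = 0]. *)
Lemma closure_PL d (f : dhomog n R d) :
  closure (PL K v d) f -> unit_at v d f -> PL K v d f.
Proof.
move=> clf fv; split => //; apply/(LorentzianP K v) => //.
have PLlor g : PL K v d g -> lorentzian K d g by move=> [/(LorentzianP K v Kv)].
have f_pos : forall us, size us = d -> (forall u, u \in us -> K u) -> 0 < polar us f.
  apply: polar_gt0_of_ge0; last first.
    by rewrite (iffLR (polar_diag_unit _ _) fv) ltr0n fact_gt0.
  move=> us us_d Kus; apply: (closure_ge0 _ _ _ _ clf (cvg_polar _ us f)) => g /PLlor[_ + _].
  by move=> /(_ _ us_d Kus)/ltW.
split=> // [|vs vs_d Kvs]; first exact: dhomog_is_dhomog.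
exists (hessian (dirDs vs f) *m v^T) => x.
rewrite /linform mulmxA -/(qform _ x v) !qform_hessian => xv.
have p0 : 0 < polar [:: v, v & vs] f.
  by apply: f_pos => //; apply: inK_cons => //; apply: inK_cons.
have : 0 <= polar [:: x, v & vs] f ^+ 2 - polar [:: x, x & vs] f * polar [:: v, v & vs] f.
  apply: (closure_ge0 _ _ (fun g : dhomog n R d => polar [:: x, v & vs] g ^+ 2 -
    polar [:: x, x & vs] g * polar [:: v, v & vs] g) _ clf).
    have c a := cvg_polar _ a f.
    exact: (cvgB (cvgM (c [:: x, v & vs]) (c _)) (cvgM (c [:: x, x & vs]) (c [:: v, v & vs]))).
  move=> g /PLlor g_lor; rewrite subr_ge0.
  exact: (lorentzian_CS K d g g_lor).
by rewrite xv expr0n sub0r oppr_ge0 pmulr_lle0.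
Qed.

End Closedness.

(** * The deformation of a form *)

Section Homotopy.
Context {R : realType} {n : nat} (K : set 'rV[R]_n) (v : 'rV[R]_n).
Hypotheses (K_open : open K) (K_convex : convex_set K) (K_cone : is_cone K).
Hypothesis (Kv : K v).
Implicit Types (u w x y p : 'rV[R]_n) (l : 'cV[R]_n).
Context {m : nat} (M : 'M[R]_(n, m)).
Hypothesis dualM : forall j, dual_normalized K v (col j M).
Hypothesis linealityM : forall x, lineality K x <-> x *m M = 0.
Hypothesis m_gt0 : (0 < m)%N.
Variable (d : nat).
Hypothesis (d_gt0 : (0 < d)%N).

Local Notation l0 := (dual_mean M).

(** The coefficients satisfy [a + b d = 1], which preserves the value at [v] for normalised [l]; and
    [a] stays positive up to [t = 1]. *)
Definition nuijs (t : R) (ls : seq 'cV[R]_n) (f : mpoly n R) : mpoly n R :=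
  foldr (fun l g => nuij v (1 - t / 2) (t / (2 * d%:R)) l g) f ls.

Lemma nuijs_cons t l ls f : nuijs t (l :: ls) f =
  nuij v (1 - t / 2) (t / (2 * d%:R)) l (nuijs t ls f).
Proof. by []. Qed.

(** The outer parameter [t / 2] stays strictly between 0 and 1 even at [t = 1], where the inner
    contraction collapses. *)
Definition deform (t : R) (f : mpoly n R) : mpoly n R :=
  contract_form v d (t / 2) l0
    (nuijs t [seq col j M | j <- enum 'I_m] (contract_form v d t l0 f)).

Lemma homog_nuijs t ls f : homog d f -> homog d (nuijs t ls f).
Proof. by move=> hf; elim: ls => [//|l ls IH]; rewrite nuijs_cons; exact: homog_nuij. Qed.

Lemma homog_deform t f : homog d f -> homog d (deform t f).
Proof. by move=> hf; apply/homog_contract/homog_nuijs/homog_contract. Qed.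

Definition deformation (z : R * dhomog n R d) : dhomog n R d :=
  DHomog (homog_deform z.1 z.2 (dhomog_is_dhomog z.2)).

Lemma lorentzian_nuijs t ls f : 0 <= t <= 1 ->
  (forall l, l \in ls -> dual_normalized K v l) ->
  lorentzian K d f -> lorentzian K d (nuijs t ls f).
Proof.
move=> /andP[t0 t1]; elim: ls f => [//|l ls IH] f Dls f_lor; rewrite nuijs_cons.
have [l_ge0 _] := Dls l (mem_head _ _).
have a0 : 0 < 1 - t / 2 by lra.
have b0 : 0 <= t / (2 * d%:R) by rewrite divr_ge0 // mulr_ge0.
apply: (lorentzian_nuij K v Kv d _ _ l _ d_gt0 a0 b0 l_ge0).
by apply: IH f_lor => k kls; apply: Dls; rewrite inE kls orbT.
Qed.

(** By [nuij_kernel] each operator in turn forces its own form to vanish at [x]. *)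
Lemma nuijs_kernel t ls f x : (1 < d)%N -> 0 < t <= 1 ->
  (forall l, l \in ls -> dual_normalized K v l) ->
  lorentzian K d f -> dirD x (nuijs t ls f) = 0 ->
  forall l, l \in ls -> linform l x = 0.
Proof.
move=> d2 /andP[t0 t1] + f_lor; elim: ls => [//|l ls IH] Dls; rewrite nuijs_cons => xT k.
have Dls' : forall l, l \in ls -> dual_normalized K v l.
  by move=> k' kls; apply: Dls; rewrite inE kls orbT.
have [_ lv] := Dls l (mem_head _ _).
have a0 : 0 < 1 - t / 2 by lra.
have b0 : 0 < t / (2 * d%:R) by rewrite divr_gt0 // mulr_gt0 ?ltr0n.
have t01 : 0 <= t <= 1 by rewrite (ltW t0).
have lor := lorentzian_nuijs t ls f t01 Dls' f_lor.
have [lx xf] := nuij_kernel K v K_open Kv d _ _ l _ x d2 a0 b0 lv lor xT.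
by rewrite inE => /predU1P[->//|]; exact: IH.
Qed.

Let dual_cols l : l \in [seq col j M | j <- enum 'I_m] -> dual_normalized K v l.
Proof. by move=> /mapP[j _ ->]. Qed.

Lemma lorentzian_core t f : 0 <= t <= 1 -> lorentzian K d f ->
  lorentzian K d (nuijs t [seq col j M | j <- enum 'I_m] (contract_form v d t l0 f)).
Proof.
move=> t01 f_lor; apply: (lorentzian_nuijs _ _ _ t01 dual_cols).
apply: (lorentzian_contract K v _ _ _ _ _ f_lor) => u.
exact: (contr_mx_cone K v K_open K_convex K_cone Kv M dualM m_gt0).
Qed.

Lemma lorentzian_deform t f : 0 <= t <= 1 -> lorentzian K d f ->
  lorentzian K d (deform t f).
Proof.
move=> t01 f_lor.
apply: (lorentzian_contract K v _ _ _ _ _ (lorentzian_core t f t01 f_lor)) => u.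
by apply: (contr_mx_cone K v K_open K_convex K_cone Kv M dualM m_gt0); lra.
Qed.

Lemma polar_diag_deform t f : homog d f ->
  polar (nseq d v) (deform t f) = polar (nseq d v) f.
Proof.
move=> hf.
have diag_contract s g : homog d g ->
    polar (nseq d v) (contract_form v d s l0 g) = polar (nseq d v) g.
  move=> hg; rewrite polar_contract ?size_nseq // map_nseq.
  by rewrite (contr_mx_v K v M dualM m_gt0).
rewrite diag_contract; last by apply/homog_nuijs/homog_contract.
elim: (enum 'I_m) => [|j r IH]; [exact: diag_contract|rewrite map_cons nuijs_cons].
have [_ lv] := dualM j.
have E : 1 - t / 2 + t / (2 * d%:R) * d%:R = 1.
  by field; rewrite pnatr_eq0 gtn_eqF.
by rewrite polar_nuij_diag // IH E mul1r.
Qed.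

Lemma deform0 f : deform 0 f = f.
Proof.
rewrite /deform mul0r !contract_form0; elim: (enum 'I_m) => [//|j r IH].
rewrite map_cons nuijs_cons IH.
by rewrite /nuij !mul0r subr0 scale1r scale0r addr0.
Qed.

Lemma deform1 f : homog d f -> polar (nseq d v) f = d`!%:R ->
  deform 1 f = deform 1 (linpoly l0 ^+ d).
Proof.
move=> hf f1.
have d0 : (d`!%:R : R) != 0 by rewrite pnatr_eq0 -lt0n fact_gt0.
have l1 : polar (nseq d v) (linpoly l0 ^+ d) = d`!%:R.
  rewrite polar_linpolyX ?size_nseq // big1_seq ?mulr1 // => u /andP[_ /nseqP[-> _]].
  exact: (dual_mean_v K v M dualM m_gt0).
rewrite /deform !contract_form1 //; last exact: homog_linpolyX.
by rewrite f1 l1.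
Qed.

(** Every column of [M] vanishes on the kernel of the core form, so that kernel is within the
    lineality space, as [contract_interior] requires. *)
Lemma deformation_interior t (f : dhomog n R d) : 0 < t <= 1 -> lorentzian K d f ->
  {near deformation (t, f), forall (g : dhomog n R d),
    (forall w, lineality K w -> dirD w g = 0) -> lorentzian K d g}.
Proof.
move=> /andP[t0 t1] f_lor; have t01 : 0 <= t <= 1 by rewrite (ltW t0).
apply: (contract_interior K v K_open K_convex K_cone Kv M dualM linealityM m_gt0 d
   (nuijs t [seq col j M | j <- enum 'I_m] (contract_form v d t l0 f)) _ (t / 2)
   (lorentzian_core t f t01 f_lor)).
- by lra.
- by [].
move=> d2 x xh; apply/linealityM/rowP => j; rewrite -linform_col [RHS]mxE.
apply: (nuijs_kernel t _ _ x d2 _ dual_cols _ xh); first by rewrite t0.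
- apply: (lorentzian_contract K v _ _ _ _ _ f_lor) => u.
  exact: (contr_mx_cone K v K_open K_convex K_cone Kv M dualM m_gt0).
by apply/mapP; exists j; rewrite ?mem_enum.
Qed.

Lemma cvgX (T : Type) (F : set_system T) (FF : Filter F) (a : T -> R) (a0 : R) k :
  a @ F --> a0 -> a x ^+ k @[x --> F] --> a0 ^+ k.
Proof.
move=> ha; elim: k => [|k IH]; first by under eq_fun do rewrite expr0; exact: cvg_cst.
by under eq_fun do rewrite exprS; rewrite exprS; exact: cvgM.
Qed.

Lemma mcvg_contract (T : Type) (F : set_system T) (FF : Filter F) (s : T -> R)
    (s0 : R) l (g : T -> mpoly n R) g0 : s @ F --> s0 -> mcvg F g g0 ->
  mcvg F (fun z => contract_form v d (s z) l (g z)) (contract_form v d s0 l g0).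
Proof.
move=> hs hg; apply: mcvg_sum => k _; apply: mcvgZ.
  apply: cvgMl; apply: cvgM; apply: cvgX => //.
  by apply: cvgB => //; exact: cvg_cst.
apply: mcvgMl; elim: (k : nat) => //= i IH; apply: mcvg_dirD => // j.
exact: cvg_cst.
Qed.

Lemma mcvg_nuijs (T : Type) (F : set_system T) (FF : Filter F) (s : T -> R)
    (s0 : R) ls (g : T -> mpoly n R) g0 : s @ F --> s0 -> mcvg F g g0 ->
  mcvg F (fun z => nuijs (s z) ls (g z)) (nuijs s0 ls g0).
Proof.
move=> hs hg; elim: ls => [//|l ls IH]; apply: mcvgD; apply: mcvgZ => //.
- by apply: cvgB; [exact: cvg_cst|exact: cvgMl].
- exact: cvgMl.
- apply: mcvgMl; apply: mcvg_dirD => // j; exact: cvg_cst.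
Qed.

Lemma deformation_continuous : continuous deformation.
Proof.
move=> [t f]; apply: cvg_form => /=.
have ht : (fun z : R * dhomog n R d => z.1) @ (t, f) --> t by exact: cvg_fst.
apply: mcvg_contract; first by apply: cvgMl.
apply: mcvg_nuijs => //; apply: mcvg_contract => //.
move=> k; apply: (@cvg_comp _ _ _ snd (fun g' : dhomog n R d => mcoeff k g')
  (nbhs (t, f)) (nbhs f)); [exact: cvg_snd|exact: mcvg_id].
Qed.

End Homotopy.

(** * Closure, interior and contractibility within the normalised forms *)

Section RelativeTopology.
Context {R : realType} {n d : nat} (K : set 'rV[R]_n) (v : 'rV[R]_n).
Hypotheses (K_open : open K) (K_convex : convex_set K) (K_cone : is_cone K).
Hypotheses (Kv : K v) (d_gt0 : (0 < d)%N).

Local Notation A := (Hspace K d `&` unit_at v d).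

Lemma PL_subset : PL K v d `<=` A.
Proof.
move=> f [/(LorentzianP K v Kv) f_lor fv]; split => // w Lw.
exact: (lorentzian_lineality K v K_open K_convex K_cone Kv d f f_lor).
Qed.

Lemma rel_closure_PL (S : set (dhomog n R d)) f :
  S `<=` PL K v d -> rel_closure A S f -> PL K v d f.
Proof.
move=> SPL [Af clf]; apply: (closure_PL K v K_open Kv); last by case: Af.
(* A neighbourhood of [f] is also one in the subspace topology of [A]. *)
move=> U fU; have [|g [Sg Ug]] := clf U; last by exists g; split => //; exact: SPL.
have : within A (nbhs f) U by apply: filterS fU.
by rewrite (nbhs_subspace_in Af).
Qed.

Hypothesis KT : K <> setT.

(** Without columns the kernel would be the whole space, so [- v] would be in the lineality
    space. *)
Lemma exists_positive_dual_matrix : exists m (M : 'M[R]_(n, m)),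
  [/\ forall j, dual_normalized K v (col j M),
      forall x, lineality K x <-> x *m M = 0 & (0 < m)%N].
Proof.
have [m [M [dualM LM]]] := exists_dual_matrix K v K_open K_convex K_cone Kv.
exists m, M; split => //; rewrite lt0n; apply/eqP => m0.
apply: (not_lineality_v K v K_open K_convex K_cone Kv KT); apply/LM.
by apply/rowP => -[j jm]; exfalso; rewrite m0 in jm.
Qed.

Context {m : nat} (M : 'M[R]_(n, m)).
Hypothesis dualM : forall j, dual_normalized K v (col j M).
Hypothesis linealityM : forall x, lineality K x <-> x *m M = 0.
Hypothesis m_gt0 : (0 < m)%N.

Local Notation F := (deformation v M d d_gt0).

Lemma deformation_PL t f : 0 <= t <= 1 -> PL K v d f -> PL K v d (F (t, f)).
Proof.
move=> t01 [/(LorentzianP K v Kv) f_lor fv]; split.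
  apply/(LorentzianP K v Kv).
  exact: (lorentzian_deform K v K_open K_convex K_cone Kv M dualM m_gt0 d d_gt0).
apply/polar_diag_unit; rewrite (polar_diag_deform K v M dualM m_gt0) //.
  exact/polar_diag_unit.
exact: dhomog_is_dhomog.
Qed.

Lemma deformation_rel_interior t f : 0 < t <= 1 -> PL K v d f ->
  rel_interior A (PL K v d) (F (t, f)).
Proof.
move=> t01 PLf; have t01' : 0 <= t <= 1 by case/andP: t01 => /ltW -> ->.
have AF : A (F (t, f)) by apply/PL_subset/deformation_PL.
split => //; rewrite /interior /= -[nbhs _]/(nbhs_subspace _) -(nbhs_subspace_in AF).
have [/(LorentzianP K v Kv) f_lor _] := PLf.
have := deformation_interior K v K_open K_convex K_cone Kv M dualM linealityM
  m_gt0 d d_gt0 t f t01 f_lor.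
apply: filterS => g g_lor [Hg gv]; split => //.
by apply/(LorentzianP K v Kv); exact: g_lor.
Qed.

Lemma deformation0 f : F (0, f) = f.
Proof. by apply: val_inj; exact: deform0. Qed.

(** The interior points [F (t, f)] approach [f] as [t] decreases to 0. *)
Lemma PL_rel_closure f : PL K v d f ->
  rel_closure A (rel_interior A (PL K v d)) f.
Proof.
move=> PLf; have Af := PL_subset _ PLf; split => // U.
rewrite -[nbhs _]/(nbhs_subspace _) -(nbhs_subspace_in Af) => fU.
have F_cvg : (fun t : R => F (t, f)) @ 0^'+ --> f.
  rewrite -[X in _ --> X]deformation0; apply: cvg_at_right_filter.
  apply: (@cvg_comp _ _ _ (fun t : R => (t, f)) F (nbhs (0 : R)) (nbhs (0 : R, f))).
    exact: (cvg_pair (@cvg_id _ (nbhs (0 : R))) (@cvg_cst _ f _ (nbhs (0 : R)) _)).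
  exact: deformation_continuous.
have FU := F_cvg _ fU.
have /filter_ex[t [[t0 t1] tU]] :
    \forall t \near (0 : R)^'+, (0 < t /\ t <= 1) /\ (A (F (t, f)) -> U (F (t, f))).
  near=> t; split; first split.
  - by near: t; exact: nbhs_right_gt.
  - by near: t; apply: nbhs_right_le.
  - by near: t; exact: FU.
have int := deformation_rel_interior t f _ PLf; exists (F (t, f)); split.
  by apply: int; rewrite t0.
by apply: tU; case: int => //; rewrite t0.
Unshelve. all: by end_near. Qed.

Lemma dual_mean_power_PL :
  exists f : dhomog n R d, PL K v d f.
Proof.
exists (DHomog (homog_linpolyX d (dual_mean M))); split.
  apply/(LorentzianP K v Kv); apply: lorentzian_linpolyX.
  exact: (dual_mean_gt0 K v K_open M dualM m_gt0).
apply/polar_diag_unit => /=.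
rewrite polar_linpolyX ?size_nseq // big1_seq ?mulr1 // => u /andP[_ /nseqP[-> _]].
exact: (dual_mean_v K v M dualM m_gt0).
Qed.

Lemma PL_contractible :
  exists2 f0, rel_interior A (PL K v d) f0 & contractible_to R (PL K v d) f0.
Proof.
have [f PLf] := dual_mean_power_PL.
exists (F (1, f)); first by apply: deformation_rel_interior => //; rewrite ltr01 lexx.
exists F; split.
- by apply: continuous_subspaceT; exact: deformation_continuous.
- exact: deformation_PL.
- by move=> x _; exact: deformation0.
move=> x PLx; apply: val_inj => /=.
have diag g : PL K v d g -> deform v M d 1 g = deform v M d 1 (linpoly (dual_mean M) ^+ d).
  move=> [_ gv]; apply: (deform1 K v M dualM m_gt0); first exact: dhomog_is_dhomog.
  exact/polar_diag_unit.
by rewrite (diag x) // (diag f).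
Qed.

End RelativeTopology.

(** With the zero vector in the cone, a polarisation required to be positive is zero. *)
Lemma PL_setT {R : realType} {n d : nat} (v : 'rV[R]_n) (f : dhomog n R d) :
  (0 < d)%N -> ~ PL setT v d f.
Proof.
case: d f => // d f _ [/(LorentzianP setT v I)[_ f_pos _] _].
have := f_pos (nseq d.+1 0); rewrite size_nseq /= polar0l ltxx.
by move/(_ erefl (fun _ _ => I)).
Qed.

Theorem theorem9p1 (R : realType) (n d : nat) (K : set 'rV[R]_n) (v : 'rV[R]_n)
    (K_open : open K) (K_convex : convex_set K) (K_cone : is_cone K)
    (d_ge1 : (1 <= d)%N) (Kv : K v) :
  let A := Hspace K d `&` unit_at v d in
  rel_closure A (rel_interior A (PL K v d)) = PL K v d /\
  (K <> setT ->
   exists2 f0, rel_interior A (PL K v d) f0 & contractible_to R (PL K v d) f0).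
Proof.
move=> A; split=> [|KT].
  apply/seteqP; split => f.
    apply: rel_closure_PL => // g [Ag /=]; case: (nbhs_subspaceP A g) => //.
    by move=> _ /nbhs_singleton; apply.
  (* When [K] is the whole space there is no such [f]; otherwise the deformation applies. *)
  have [KT|KT] := pselect (K = setT).
    by rewrite KT => /PL_setT; case.
  have [m [M [dualM LM m_gt0]]] :=
    exists_positive_dual_matrix K v K_open K_convex K_cone Kv KT.
  exact: (PL_rel_closure K v K_open K_convex K_cone Kv d_ge1 M dualM LM m_gt0).
have [m [M [dualM LM m_gt0]]] :=
  exists_positive_dual_matrix K v K_open K_convex K_cone Kv KT.
exact: (PL_contractible K v K_open K_convex K_cone Kv d_ge1 M dualM LM m_gt0).
Qed.
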